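(* Let $\mathcal R=(\mathbb R,<,+,\dots)$ be an expansion of the ordered additive group of real numbers which is type A. Let $U\subseteq\mathbb R^n$ be a definable open set and $f:U\to\mathbb R^m$ a continuous definable function. Then for every $k\in\mathbb N$ there is a dense definable open subset of $U$ on which $f$ is $C^k$.
   Context: ''Definable'' means definable in $\mathcal R$ with parameters. A set is $\omega$-orderable if it is definable and either finite or admits a definable ordering of order type $\omega$; it is dense if dense in some nonempty open interval. $\mathcal R$ is type A if it does not define a dense $\omega$-orderable set. *)

(* Defs.v *)
From HB Require Import structures.
From mathcomp Require Import all_boot all_order all_algebra.
From mathcomp Require Import all_classical all_reals all_analysis.

Set Implicit Arguments.
Unset Strict Implicit.
Unset Printing Implicit Defensive.

Import Order.TTheory GRing.Theory Num.Theory.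
Import numFieldNormedType.Exports.

Local Open Scope classical_set_scope.
Local Open Scope ring_scope.

(** Symbols of the language other than [=], [<] and [+]. *)
Record signature := Signature {
  fsym : Type;
  farity : fsym -> nat;
  rsym : Type;
  rarity : rsym -> nat }.

(** An expansion of [(R, <, +)] only has to interpret the extra symbols: [<] and
    [+] are logical symbols below and always have their standard meaning. *)
Record expansion (R : realType) (L : signature) := Expansion {
  fint : forall s : fsym L, 'rV[R]_(farity s) -> R;
  rint : forall s : rsym L, set 'rV[R]_(rarity s) }.

Section FirstOrder.
Context (R : realType) (L : signature).

(** Terms and formulas whose free variables are among [x_0, ..., x_(n-1)], with
    every real number available as a parameter ([Par]).  The variable bound by
    [Ex] is the last one, [x_n]. *)
Inductive term (n : nat) : Type :=
| Var of 'I_n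
| Par of R
| Add of term n & term n
| App (s : fsym L) of ('I_(farity s) -> term n).

Inductive formula : nat -> Type :=
| Eq n of term n & term n : formula n
| Lt n of term n & term n : formula n
| Rel n (s : rsym L) of ('I_(rarity s) -> term n) : formula n
| Not n of formula n : formula n
| And n of formula n & formula n : formula n
| Ex n of formula (n + 1) : formula n.

Variable M : expansion R L.

Fixpoint eval n (t : term n) (x : 'rV[R]_n) : R :=
  match t with
  | Var i => x ord0 i
  | Par r => r
  | Add t1 t2 => eval t1 x + eval t2 x
  | App s ts => fint M (\row_i eval (ts i) x)
  end.

Fixpoint holds n (phi : formula n) : 'rV[R]_n -> Prop :=
  match phi with
  | Eq _ t1 t2 => fun x => eval t1 x = eval t2 x
  | Lt _ t1 t2 => fun x => eval t1 x < eval t2 x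
  | Rel _ s ts => fun x => rint M (\row_i eval (ts i) x)
  | Not _ p => fun x => ~ holds p x
  | And _ p q => fun x => holds p x /\ holds q x
  | Ex _ p => fun x => exists a : R, holds p (row_mx x a%:M)
  end.

Definition definable n (A : set 'rV[R]_n) : Prop :=
  exists phi : formula n, A = [set x | holds phi x].

Definition definable_rel n m (S : set ('rV[R]_n * 'rV[R]_m)) : Prop :=
  definable [set row_mx p.1 p.2 | p in S].

(** Only the values of [f] on [U] matter. *)
Definition definable_fun n m (U : set 'rV[R]_n) (f : 'rV[R]_n -> 'rV[R]_m) :
  Prop := definable_rel [set p | U p.1 /\ p.2 = f p.1].

(** [S] is a strict ordering of [A], and [e] an isomorphism from [(nat, <)] onto
    [(A, S)]. *)
Definition order_type_omega T (A : set T) (S : set (T * T)) : Prop :=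
  S `<=` A `*` A /\
  exists e : nat -> T, set_bij [set: nat] A e /\
    forall i j : nat, S (e i, e j) <-> (i < j)%N.

Definition omega_orderable n (A : set 'rV[R]_n) : Prop :=
  definable A /\
  (finite_set A \/
   exists S : set ('rV[R]_n * 'rV[R]_n),
     definable_rel S /\ order_type_omega A S).

Definition somewhere_dense (D : set R) : Prop :=
  exists I : set R, [/\ is_interval I, open I, I !=set0 & I `<=` closure D].

Definition typeA : Prop :=
  ~ exists D : set R,
      omega_orderable [set x : 'rV[R]_1 | D (x ord0 ord0)] /\ somewhere_dense D.

End FirstOrder.

(** [f] is C^k on [V], for [V] open: all iterated partial derivatives of [f] of
    order at most [k] exist and are continuous on [V]. *)
Fixpoint Ck (R : realType) (n m k : nat) (V : set 'rV[R]_n)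
    (f : 'rV[R]_n -> 'rV[R]_m) : Prop :=
  {within V, continuous f} /\
  match k with
  | 0 => True
  | k'.+1 => forall i : 'I_n,
      (forall x, V x -> derivable f x (delta_mx ord0 i)) /\
      Ck k' V (fun x => 'D_(delta_mx ord0 i) f x)
  end.

(* Main.v *)
From HB Require Import structures.
Require Import Defs.
From mathcomp Require Import all_boot all_order all_algebra finmap.
From mathcomp Require Import all_classical all_reals all_analysis.
From mathcomp Require Import ring lra.
Import Order.TTheory GRing.Theory Num.Theory.
Import numFieldNormedType.Exports.

(** Only addition is available, so derivatives are not definable, but iterated
    differences are.  Fix a vector [v] with natural coordinates.  The heart of
    the matter is that on small balls the [j]-th difference of [f] with step
    [h v] has a constant sign for all small [h > 0].

    On a line, let [S h] be the closed set of those [t] at which the difference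
    with step [h] is nonnegative.  If at some point the sign oscillates as
    [h -> 0], then picking record gaps between consecutive sign changes gives a
    definable set [H] which is a sequence decreasing to 0.  The left ends of the
    gaps of length [>= d] of [S h], for [h] and [d] in [H], form an
    omega-orderable set, which type A forces not to be dense; off its closure
    each [S h] is upward closed, so the sign is constant on an interval for
    infinitely many [h] in [H], hence, adding up small steps, for all small [h].
    If no such [H] is definable, then the sign is eventually constant as
    [h -> 0] at every point.  In both cases Baire's theorem turns the
    pointwise statement into a statement on a ball.

    A constant sign of the differences of order [j + 1] bounds the [j]-th
    differences by [C h ^ j]; polarization extends the bounds to mixed
    differences; and bounds on all mixed differences of order at most [k + 1]
    imply that [f] is C^k, one derivative at a time. *)

Set Implicit Arguments.
Unset Strict Implicit.
Unset Printing Implicit Defensive.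

Local Open Scope classical_set_scope.
Local Open Scope ring_scope.

(** * Definability *)

Section Definability.
Context (R : realType) (L : signature) (M : expansion R L).

Fixpoint tsubst n m (s : 'I_n -> term R L m) (t : term R L n) : term R L m :=
  match t with
  | Var i => s i
  | Par r => Par L m r
  | Add t1 t2 => Add (tsubst s t1) (tsubst s t2)
  | App g ts => App (fun i => tsubst s (ts i))
  end.

Lemma eval_tsubst n m (s : 'I_n -> term R L m) t x :
  Defs.eval M (tsubst s t) x = Defs.eval M t (\row_i Defs.eval M (s i) x).
Proof.
elim: t => [i|r|t1 IH1 t2 IH2|g ts IH] /=; rewrite ?mxE ?IH1 ?IH2 //.
by congr (fint M _); apply/rowP => i; rewrite !mxE IH.
Qed.

Definition subst_lift n m (s : 'I_n -> term R L m) (i : 'I_(n + 1)) :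
    term R L (m + 1) :=
  match fintype.split i with
  | inl j => tsubst (fun k => Var R L (lshift 1 k)) (s j)
  | inr k => Var R L (rshift m k)
  end.

Fixpoint fsubst n (phi : formula R L n) :
    forall m, ('I_n -> term R L m) -> formula R L m :=
  match phi with
  | Eq _ t1 t2 => fun m s => Eq (tsubst s t1) (tsubst s t2)
  | Lt _ t1 t2 => fun m s => Lt (tsubst s t1) (tsubst s t2)
  | Rel _ r ts => fun m s => Rel (fun i => tsubst s (ts i))
  | Not _ p => fun m s => Not (fsubst p s)
  | And _ p q => fun m s => And (fsubst p s) (fsubst q s)
  | Ex _ p => fun m s => Ex (fsubst p (subst_lift s))
  end.

Lemma row_lift n m (s : 'I_n -> term R L m) (x : 'rV[R]_m) (a : R) :
  \row_i Defs.eval M (subst_lift s i) (row_mx x a%:M) =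
  row_mx (\row_i Defs.eval M (s i) x) a%:M.
Proof.
apply/rowP => i; rewrite !mxE /subst_lift; case: fintype.split => j.
  rewrite eval_tsubst !mxE; congr Defs.eval; apply/rowP => k.
  by rewrite mxE /= row_mxEl.
by rewrite /= row_mxEr.
Qed.

Lemma holds_fsubst n (phi : formula R L n) m (s : 'I_n -> term R L m) x :
  holds M (fsubst phi s) x <-> holds M phi (\row_i Defs.eval M (s i) x).
Proof.
elim: phi m s x => {n} [n t u|n t u|n r ts|n p IH|n p IHp q IHq|n p IH] m s x /=.
- by rewrite !eval_tsubst.
- by rewrite !eval_tsubst.
- suff -> : \row_i Defs.eval M (tsubst s (ts i)) x =
    \row_i Defs.eval M (ts i) (\row_j Defs.eval M (s j) x) by [].
  by apply/rowP => i; rewrite !mxE eval_tsubst.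
- by rewrite IH.
- by rewrite IHp IHq.
- by split=> -[a pa]; exists a; move: pa; rewrite IH row_lift.
Qed.

(* Formulas have a fixed number of variables; a property of infinite sequences
   depending on finitely many entries lets quantifiers and substitutions be
   written directly on the environment, [e 0] being the innermost variable. *)
Definition env_row n (e : nat -> R) : 'rV[R]_n := \row_i e i.

Definition Def (P : (nat -> R) -> Prop) :=
  exists n (phi : formula R L n), forall e, P e <-> holds M phi (env_row n e).

Definition Dfun (t : (nat -> R) -> R) :=
  Def (fun e => e 0%N = t (fun i => e i.+1)).

Lemma def_iff P Q : (forall e, P e <-> Q e) -> Def P -> Def Q.
Proof. by move=> PQ [n [phi H]]; exists n, phi => e; rewrite -PQ. Qed.

Lemma def_rename P (sigma : nat -> nat) :
  Def P -> Def (fun e => P (fun i => e (sigma i))).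
Proof.
move=> [n [phi H]].
pose m := (\max_(i < n) sigma i).+1.
have sm (i : 'I_n) : (sigma i < m)%N by rewrite ltnS (leq_bigmax i).
exists m, (fsubst phi (fun i => Var R L (Ordinal (sm i)))) => e.
rewrite H holds_fsubst /=.
suff -> : env_row n (fun i => e (sigma i)) =
  \row_i env_row m e ord0 (Ordinal (sm i)) by [].
by apply/rowP => i; rewrite !mxE.
Qed.

Lemma formula_widen n (phi : formula R L n) N : (n <= N)%N ->
  exists psi : formula R L N,
    forall e, holds M psi (env_row N e) <-> holds M phi (env_row n e).
Proof.
move=> nN; exists (fsubst phi (fun i => Var R L (widen_ord nN i))) => e.
rewrite holds_fsubst /=.
suff -> : \row_i env_row N e ord0 (widen_ord nN i) = env_row n e by [].
by apply/rowP => i; rewrite !mxE.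
Qed.

Lemma def_not P : Def P -> Def (fun e => ~ P e).
Proof. by move=> [n [phi H]]; exists n, (Not phi) => e /=; rewrite H. Qed.

Lemma def_and P Q : Def P -> Def Q -> Def (fun e => P e /\ Q e).
Proof.
move=> [n [phi H]] [m [psi K]].
have [phi' H'] := formula_widen phi (leq_maxl n m).
have [psi' K'] := formula_widen psi (leq_maxr n m).
by exists (maxn n m), (And phi' psi') => e /=; rewrite H K H' K'.
Qed.

Lemma def_or P Q : Def P -> Def Q -> Def (fun e => P e \/ Q e).
Proof.
move=> dP dQ.
apply: (@def_iff (fun e => ~ (~ P e /\ ~ Q e))) => [e|].
  by rewrite not_andE !notK.
by apply: def_not; apply: def_and; apply: def_not.
Qed.

Lemma def_imply P Q : Def P -> Def Q -> Def (fun e => P e -> Q e).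
Proof.
move=> dP dQ; apply: (@def_iff (fun e => ~ P e \/ Q e)) => [e|].
  by rewrite implyE.
by apply: def_or => //; apply: def_not.
Qed.

Lemma def_equiv P Q : Def P -> Def Q -> Def (fun e => P e <-> Q e).
Proof. by move=> dP dQ; apply: def_and; apply: def_imply. Qed.

Lemma def_ex (P : R -> (nat -> R) -> Prop) :
  Def (fun e => P (e 0%N) (fun i => e i.+1)) -> Def (fun e => exists a, P a e).
Proof.
move=> [n [phi H]].
(* Entry [0] is the innermost one of an environment, but [Ex] binds the last variable; [s] exchanges
   these conventions. *)
pose s (i : 'I_n) : term R L (n + 1) :=
  if i == 0%N :> nat then Var R L (rshift n ord0)
  else Var R L (lshift 1 (Ordinal (leq_ltn_trans (leq_pred i) (ltn_ord i)))).
exists n, (Ex (fsubst phi s)) => e /=.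
suff E a : P a e <-> holds M (fsubst phi s) (row_mx (env_row n e) a%:M).
  by split=> -[a pa]; exists a; apply/E.
rewrite (H (fun i => if i is j.+1 then e j else a)) holds_fsubst.
suff -> : \row_i Defs.eval M (s i) (row_mx (env_row n e) a%:M) =
  env_row n (fun i => if i is j.+1 then e j else a) by [].
apply/rowP => i; rewrite !mxE /s; case: ifPn => [/eqP -> /=|].
  by rewrite row_mxEr mxE.
by case: i => -[//|i] lin _ /=; rewrite row_mxEl mxE.
Qed.

Lemma def_forall (P : R -> (nat -> R) -> Prop) :
  Def (fun e => P (e 0%N) (fun i => e i.+1)) ->
  Def (fun e => forall a, P a e).
Proof.
move=> dP; apply: (@def_iff (fun e => ~ exists a, ~ P a e)) => [e|].
  by split=> [nP a|aP [a]//]; apply: contrapT => nPa; apply: nP; exists a.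
apply: def_not; apply: (@def_ex (fun a e => ~ P a e)).
exact: def_not.
Qed.

Lemma def_exv n (P : 'rV[R]_n -> (nat -> R) -> Prop) :
  Def (fun e => P (env_row n e) (fun i => e (n + i)%N)) ->
  Def (fun e => exists x, P x e).
Proof.
elim: n P => [|n IH] P dP.
  apply: def_iff dP => e; split=> [|[x]]; first by exists (env_row 0 e).
  by have -> : x = env_row 0 e by apply/rowP => -[].
pose cons a (x : 'rV[R]_n) : 'rV[R]_n.+1 := row_mx (a%:M : 'rV[R]_1) x.
apply: (@def_iff (fun e => exists a, exists x, P (cons a x) e)) => [e|].
  split=> [[a [x Px]]|[x Px]]; first by exists (cons a x).
  exists (x ord0 ord0), (rsubmx (x : 'rV[R]_(1 + n))).
  suff E : (x ord0 ord0)%:M = lsubmx (x : 'rV[R]_(1 + n)).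
    by rewrite /cons E hsubmxK.
  apply/rowP => i; rewrite [i]ord1 !mxE eqxx mulr1n.
  by congr (x _ _); apply: val_inj.
apply: (@def_ex (fun a e => exists x, P (cons a x) e)).
apply: (IH (fun x e => P (cons (e 0%N) x) (fun i => e i.+1))).
(* The entries are now those of the tail [x], then the head at index [n], then the rest; a cyclic
   renaming of the first [n + 1] indices puts the head in front. *)
apply: def_iff (def_rename (fun i => if (i < n.+1)%N then
  (if i is j.+1 then j else n) else i) dP) => e.
suff -> : env_row n.+1 (fun i => e (if (i < n.+1)%N then
    (if i is j.+1 then j else n) else i)) = cons (e (n + 0)%N) (env_row n e).
  suff -> : (fun i => e (if (n.+1 + i < n.+1)%N then
    (if (n.+1 + i)%N is j.+1 then j else n) else (n.+1 + i)%N)) =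
    (fun i => e (n + i.+1)%N) by [].
  by apply/funext => i; rewrite ltnNge leq_addr /= addSnnS.
apply/rowP => i; rewrite !mxE ltn_ord.
case: splitP => [j|j] ij; first by rewrite ij ord1 mxE /= addn0.
by rewrite ij mxE.
Qed.

Lemma def_forallv n (P : 'rV[R]_n -> (nat -> R) -> Prop) :
  Def (fun e => P (env_row n e) (fun i => e (n + i)%N)) ->
  Def (fun e => forall x, P x e).
Proof.
move=> dP; apply: (@def_iff (fun e => ~ exists x, ~ P x e)) => [e|].
  by split=> [nP a|aP [a]//]; apply: contrapT => nPa; apply: nP; exists a.
apply: def_not; apply: (@def_exv _ (fun x e => ~ P x e)).
exact: def_not.
Qed.

Lemma def_cst (P : Prop) : Def (fun=> P).
Proof.
pose t : formula R L 0 := Eq (Par L 0 0) (Par L 0 (if `[<P>] then 0 else 1)).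
exists 0%N, t => e /=; case: asboolP => // nP; split=> // /eqP.
by rewrite eq_sym oner_eq0.
Qed.

Lemma def_forall_fin (I : finType) (P : I -> (nat -> R) -> Prop) :
  (forall i, Def (P i)) -> Def (fun e => forall i, P i e).
Proof.
move=> dP.
suff H (s : seq I) : Def (fun e => forall i, i \in s -> P i e).
  apply: def_iff (H (enum I)) => e.
  by split=> [H1 i|H1 i _]; [apply: H1; rewrite mem_enum|exact: H1].
elim: s => [|j s IH]; first by apply: def_iff (def_cst True).
apply: def_iff (def_and (dP j) IH) => e; split=> [[Pj Ps] i|H].
  by rewrite inE => /orP[/eqP ->|/Ps].
by split=> [|i si]; apply: H; rewrite inE ?eqxx // si orbT.
Qed.

(** The functions [t i] are known only through their graphs, so the values of the finitely many that
    matter are quantified existentially. *)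
Lemma def_subst P (t : nat -> (nat -> R) -> R) : (forall i, Dfun (t i)) ->
  Def P -> Def (fun e => P (fun i => t i e)).
Proof.
move=> dt [n [phi H]].
pose Q (x : 'rV[R]_n) e := (forall i : 'I_n, x ord0 i = t i e) /\ holds M phi x.
apply: (@def_iff (fun e => exists x, Q x e)) => [e|].
  rewrite H; split=> [[x [xt]]|h]; last first.
    by exists (env_row n (t^~ e)); split => // i; rewrite mxE.
  by have -> : x = env_row n (t^~ e) by apply/rowP => i; rewrite mxE.
apply: def_exv; apply: def_and; last by exists n, phi.
apply: def_forall_fin => i.
apply: def_iff (def_rename (fun k => if k is j.+1 then (n + j)%N else i) (dt i)).
by move=> e; rewrite mxE.
Qed.

Lemma dfun_ext t u : t =1 u -> Dfun t -> Dfun u.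
Proof. by move=> /funext ->. Qed.

Lemma dfun_var i : Dfun (fun e => e i).
Proof.
exists i.+2, (Eq (Var R L ord0) (Var R L (@Ordinal i.+2 i.+1 (ltnSn _)))) => e.
by rewrite /= !mxE.
Qed.

Lemma dfun_cst r : Dfun (fun=> r).
Proof. by exists 1%N, (Eq (Var R L ord0) (Par L _ r)) => e; rewrite /= !mxE. Qed.

Lemma dfun_rename t (sigma : nat -> nat) :
  Dfun t -> Dfun (fun e => t (fun i => e (sigma i))).
Proof.
by move=> /(def_rename (fun i => if i is j.+1 then (sigma j).+1 else 0%N)).
Qed.

Lemma def_lt t u : Dfun t -> Dfun u -> Def (fun e => t e < u e).
Proof.
move=> dt du; have d : Def (fun e => e 0%N < e 1%N).
  exists 2%N, (Lt (Var R L ord0) (Var R L ord_max)) => e.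
  by rewrite /= !mxE.
by apply: (@def_subst _ (fun i => if i is 0%N then t else u)) d => -[].
Qed.

Lemma def_eq t u : Dfun t -> Dfun u -> Def (fun e => t e = u e).
Proof.
move=> dt du; have d : Def (fun e => e 0%N = e 1%N) by exact: dfun_var 0%N.
by apply: (@def_subst _ (fun i => if i is 0%N then t else u)) d => -[].
Qed.

Lemma def_le t u : Dfun t -> Dfun u -> Def (fun e => t e <= u e).
Proof.
move=> dt du; apply: def_iff (def_not (def_lt du dt)) => e.
by rewrite leNgt; split => /negP.
Qed.

Lemma dfun_comp g (t : nat -> (nat -> R) -> R) : (forall i, Dfun (t i)) ->
  Dfun g -> Dfun (fun e => g (fun i => t i e)).
Proof.
move=> dt; apply: (@def_subst _
  (fun i e => if i is j.+1 then t j (fun k => e k.+1) else e 0%N)) => -[|i].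
  exact: dfun_var.
exact: dfun_rename.
Qed.

Lemma dfun_add t u : Dfun t -> Dfun u -> Dfun (fun e => t e + u e).
Proof.
move=> dt du; have d : Dfun (fun e => e 0%N + e 1%N).
  exists 3%N, (Eq (Var R L ord0)
    (Add (Var R L (lift ord0 ord0)) (Var R L ord_max))) => e.
  by rewrite /= !mxE.
by apply: (@dfun_comp _ (fun i => if i is 0%N then t else u)) d => -[].
Qed.

Lemma dfun_opp t : Dfun t -> Dfun (fun e => - t e).
Proof.
move=> dt; apply: (@def_iff (fun e => e 0%N + t (fun i => e i.+1) = 0)).
  by move=> e; split=> [/eqP|->]; rewrite ?addNr // addr_eq0 => /eqP.
apply: def_eq; last exact: dfun_cst.
by apply: dfun_add; [exact: dfun_var|exact: dfun_rename].
Qed.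

Lemma dfun_muln t k : Dfun t -> Dfun (fun e => t e *+ k).
Proof.
move=> dt; elim: k => [|k IH]; first exact: dfun_cst.
by apply: dfun_ext (dfun_add dt IH) => e; rewrite mulrS.
Qed.

Lemma def_mem n (A : set 'rV[R]_n) (x : (nat -> R) -> 'rV[R]_n) :
  definable M A -> (forall i, Dfun (fun e => x e ord0 i)) ->
  Def (fun e => A (x e)).
Proof.
move=> [phi ->] dx.
have d : Def (fun e => holds M phi (env_row n e)) by exists n, phi.
apply: def_iff (def_subst (t := fun i => if insub i is Some j
  then fun e => x e ord0 j else fun=> 0) _ d).
  move=> e; suff -> : env_row n (fun i => (if insub i is Some j
    then fun e => x e ord0 j else fun=> 0) e) = x e by [].
  by apply/rowP => i; rewrite mxE valK.
by move=> i; case: insubP => [j _ _|_]; [exact: dx|exact: dfun_cst].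
Qed.

Lemma dfun_row n (F : 'rV[R]_n -> R) (x : (nat -> R) -> 'rV[R]_n) :
  Dfun (fun e => F (env_row n e)) -> (forall i, Dfun (fun e => x e ord0 i)) ->
  Dfun (fun e => F (x e)).
Proof.
move=> dF dx.
apply: dfun_ext (dfun_comp (t := fun i => if insub i is Some j
  then fun e => x e ord0 j else fun=> 0) _ dF).
  by move=> e; congr F; apply/rowP => i; rewrite mxE valK.
by move=> i; case: insubP => [j _ _|_]; [exact: dx|exact: dfun_cst].
Qed.

Lemma definable_Def n (A : set 'rV[R]_n) :
  Def (fun e => A (env_row n e)) -> definable M A.
Proof.
move=> [N [phi H]].
(* The number of variables of [phi] need not be [n]: rows are extended by [0], and variables of
   index at least [n] become the parameter [0]. *)
exists (fsubst phi (fun i => if insub (val i) is Some j then Var R L j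
  else Par L n 0)); apply/seteqP; split=> x /=; rewrite holds_fsubst.
all: pose e i := if insub i is Some j then x ord0 j else 0.
all: have -> : x = env_row n e by apply/rowP => i; rewrite mxE /e valK.
all: rewrite H.
all: set y := env_row N e; set z := \row_i _.
all: suff -> : z = y by [].
all: apply/rowP => i; rewrite !mxE {2}/e; case: insubP => //= j _ _.
all: by rewrite mxE /e valK.
Qed.

End Definability.

(** * Gaps and omega-orderable sets *)

Section RealLine.
Context (R : realType).
Implicit Types (A D H S : R -> Prop) (a b c d r s t : R).

(** Each cell of length [d] contains at most one point of [A], and finitely many cells cover the
    range. *)
Lemma finite_separated A a b d : 0 < d ->
  (forall x, A x -> a <= x <= b) ->
  (forall x y, A x -> A y -> x < y -> x + d <= y) -> finite_set [set x | A x].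
Proof.
move=> d0 Aab Asep.
pose g x := Num.trunc ((x - a) / d).
have gP x : A x -> (g x)%:R <= (x - a) / d < (g x).+1%:R.
  move=> /Aab /andP[ax _]; apply: truncn_itv.
  by rewrite divr_ge0 ?subr_ge0 // ltW.
have gN x y : A x -> A y -> x < y -> g x <> g y.
  move=> Ax Ay xy gxy; have /andP[_ +] := gP _ Ay; have /andP[+ _] := gP _ Ax.
  rewrite gxy ler_pdivlMr // ltr_pdivrMr // => h1; apply/negP; rewrite -leNgt.
  have := Asep _ _ Ax Ay xy; rewrite -natr1; nra.
have finj : {in [set x | A x] &, injective g}.
  move=> x y; rewrite !inE => Ax Ay gxy.
  by case: (ltgtP x y) => // /gN; [move=> /(_ Ax Ay)|move=> /(_ Ay Ax)]; rewrite gxy.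
(* Points outside [A] receive an index outside the finite range, so that injectivity is needed on
   [A] only. *)
apply: sub_finite_set (finite_preimage (B := `I_(Num.trunc ((b - a) / d)).+1)
    (f := fun x => if `[<A x>] then g x else (Num.trunc ((b - a) / d)).+1)
    _ (finite_II _)).
  move=> x Ax /=; rewrite asboolT // ltnS; apply: le_truncn.
  by rewrite ler_pM2r ?invr_gt0 // lerB // ; have /andP[] := Aab _ Ax.
move=> x y; rewrite !inE /=; case: asboolP => Ax; last by rewrite ltnn.
by case: asboolP => Ay; [move=> _ _; apply: finj; rewrite inE|rewrite ltnn].
Qed.

Lemma finite_min A : finite_set [set x | A x] -> (exists x, A x) ->
  exists2 m, A m & forall x, A x -> m <= x.
Proof.
move=> /finite_seqP[s As] [x0 Ax0].
have AE x : A x <-> x \in s by rewrite -[A x]/([set x | A x] x) As.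
have {Ax0}: x0 \in s by apply/AE.
suff H (l : seq R) y : y \in l -> exists2 m, m \in l & forall x, x \in l -> m <= x.
  by move=> /H[m /AE Am mP]; exists m => // x /AE /mP.
elim: l y => [//|z l IH] y _.
case: l IH => [_|w l /(_ w (mem_head _ _)) [m ml mP]].
  by exists z; [exact: mem_head|move=> x; rewrite inE => /eqP ->].
case: (leP z m) => zm.
  exists z; rewrite ?mem_head // => x; rewrite inE => /orP[/eqP -> //|/mP].
  exact: le_trans.
exists m; first by rewrite inE ml orbT.
by move=> x; rewrite inE => /orP[/eqP ->|/mP //]; exact: ltW.
Qed.

(** The set [S] is relatively closed in the open interval from [a] to [b]. *)
Definition co_open S a b := forall t, a < t < b -> ~ S t ->
  exists2 eps, 0 < eps & forall t', `|t' - t| < eps -> ~ S t'.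

(** The complementary interval starting at [c] may be longer than [d], so a gap for [d] is also one
    for every smaller length. *)
Definition gap S c d := S c /\ forall t, c < t < c + d -> ~ S t.

(** The gap starts at the supremum of the points of [S] between [s] and [p], which closedness puts
    into [S]. *)
Lemma gap_left S a b s p : co_open S a b -> a < s -> p < b -> s < p ->
  S s -> ~ S p -> exists c, [/\ s <= c, c < p & gap S c (p - c)].
Proof.
move=> So as_ pb sp Ss nSp.
pose E := [set t | S t /\ s <= t <= p]; pose c := sup E.
have Es : E s by split=> //; rewrite lexx ltW.
have Eub : ubound E p by move=> t [_ /andP[]].
have hE : has_sup E by split; [exists s|exists p].
have sc : s <= c by apply: ub_le_sup => //; exists p.
have cp : c <= p by apply: ge_sup => //; exists s.
have Sc : S c.
  apply: contrapT => nSc; have [|eps e0 nS] := So c _ nSc.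
    by rewrite (lt_le_trans as_ sc) (le_lt_trans cp pb).
  have [t [St tp] ct] := sup_adherent e0 hE.
  apply: (nS t) => //; rewrite ler0_norm ?opprB; first by rewrite /c; lra.
  by rewrite subr_le0; apply: ub_le_sup => //; exists p.
have cp' : c < p by rewrite lt_neqAle cp andbT; apply/eqP => cp0; rewrite cp0 in Sc.
exists c; split=> //; split=> // t /andP[ct tp] St.
suff : t <= c by rewrite leNgt ct.
apply: ub_le_sup; first by exists p.
by split=> //; lra.
Qed.

Lemma finite_gap S a b d : 0 < d ->
  finite_set [set c | a < c < b /\ gap S c d].
Proof.
move=> d0; apply: (@finite_separated _ a b d) => // [x [/andP[]]|].
  by move=> /ltW -> /ltW ->.
move=> x y [_ [_ gx]] [_ [Sy _]] xy; rewrite leNgt; apply/negP => yx.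
by apply: (gx y) => //; rewrite xy.
Qed.

(* The shape of a decreasing sequence converging to 0. *)
Definition null_seq H := [/\ forall h, H h -> 0 < h,
  forall eps, 0 < eps -> exists2 h, H h & h < eps &
  forall eps, 0 < eps -> finite_set [set h | H h /\ eps <= h]].

(** For some [d], the point [c] is the first one, coming from [0], at which a gap of length at least
    [d] starts. *)
Definition gap_record S r c := 0 < c < r /\ exists d, [/\ 0 < d, gap S c d &
  forall c', 0 < c' < c -> ~ gap S c' d].

(** Oscillation yields a gap whose left end is below [eps]. The first gap at least as long is a
    record below [eps]. A record at or beyond [eps] also carries a gap at least as long, and there
    are finitely many of these. *)
Lemma null_seq_gap_record S r : co_open S 0 r -> 0 < r ->
  (forall eps, 0 < eps -> exists h, [/\ 0 < h, h < eps & S h]) ->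
  (forall eps, 0 < eps -> exists h, [/\ 0 < h, h < eps & ~ S h]) ->
  null_seq (gap_record S r).
Proof.
move=> So r0 S0 nS0.
have G eps : 0 < eps -> exists c d, [/\ 0 < c, c < eps, c < r, 0 < d & gap S c d].
  move=> e0; have [|p [p0 pe nSp]] := nS0 (Num.min eps r).
    by rewrite lt_min e0.
  have [h [h0 hp Sh]] := S0 p p0; move: pe; rewrite lt_min => /andP[pe pr].
  have [c [hc cp cg]] := gap_left So h0 pr hp Sh nSp.
  exists c, (p - c); split=> //; lra.
split=> [h [/andP[]]//|eps e0|eps e0].
  have [c [d [c0 ce cr d0 cg]]] := G _ e0.
  have [|m [mc mg] mP] :=
    @finite_min (fun x => 0 < x < r /\ gap S x d) (finite_gap _ _ _ d0).
    by exists c; rewrite c0 cr.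
  exists m; last by apply: le_lt_trans ce; apply: mP; rewrite c0 cr.
  split=> //; exists d; split=> // c' /andP[c'0 c'm] g'.
  suff : m <= c' by rewrite leNgt c'm.
  by apply: mP; split=> //; move/andP: mc => [_ mr]; rewrite c'0 (lt_trans c'm).
have [c [d [c0 ce cr d0 cg]]] := G _ e0.
apply: sub_finite_set (finite_gap S 0 r d0) => x [[xr [d' [d'0 [Sx xg] xP]]] ex].
split=> //; split=> // t /andP[xt tx]; apply: xg; rewrite xt /=.
apply: (lt_le_trans tx); rewrite lerD2l leNgt; apply/negP => dd.
apply: (xP c); first by rewrite c0 (lt_le_trans ce).
split; first by case: cg.
by move=> u /andP[cu uc]; case: cg => _; apply; rewrite cu /=; lra.
Qed.

End RealLine.

(** Elements are numbered by how many predecessors they have. This rank is strictly monotone, and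
    surjective because [D] is infinite. *)
Lemma omega_enumeration (T : choiceType) (D : set T) (prec : T -> T -> Prop) :
  infinite_set D -> (forall x, ~ prec x x) ->
  (forall x y z, prec x y -> prec y z -> prec x z) ->
  (forall x y, D x -> D y -> [\/ prec x y, x = y | prec y x]) ->
  (forall x, D x -> finite_set [set y | D y /\ prec y x]) ->
  exists e : nat -> T, set_bij [set: nat] D e /\
    forall i j, prec (e i) (e j) <-> (i < j)%N.
Proof.
move=> Dinf irr tr tot fin.
pose below x := fset_set [set y | D y /\ prec y x].
pose rk x := size (enum_fset (below x)).
have rk_lt x y : D x -> D y -> prec x y -> (rk x < rk y)%N.
  move=> Dx Dy xy; apply: fproper_ltn_card; rewrite fproperEneq.
  apply/andP; split; last first.
    rewrite -fset_set_sub; [|exact: fin|exact: fin].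
    by move=> z [Dz zx]; split=> //; apply: tr xy.
  apply/eqP => E.
  have : x \in below y by rewrite /below in_fset_set ?inE //; exact: fin.
  rewrite -E /below in_fset_set; last exact: fin.
  by rewrite inE => -[_ /irr].
have rk_ltP x y : D x -> D y -> prec x y <-> (rk x < rk y)%N.
  move=> Dx Dy; split; first exact: rk_lt.
  case: (tot x y Dx Dy) => // [->|yx]; first by rewrite ltnn.
  by move=> xy; have := rk_lt _ _ Dy Dx yx; rewrite ltnNge (ltnW xy).
have rk_inj x y : D x -> D y -> rk x = rk y -> x = y.
  move=> Dx Dy E; case: (tot x y Dx Dy) => // /rk_lt.
    by move=> /(_ Dx Dy); rewrite E ltnn.
  by move=> /(_ Dy Dx); rewrite E ltnn.
have rk_fin n : finite_set [set x | D x /\ (rk x < n)%N].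
  apply: sub_finite_set (finite_preimage (B := `I_n)
    (f := fun x => if `[<D x>] then rk x else n) _ (finite_II _)).
    by move=> x [Dx xn] /=; rewrite asboolT.
  move=> x y; rewrite !inE /=; case: asboolP => Dx; last by rewrite ltnn.
  case: asboolP => Dy; last by rewrite ltnn.
  by move=> _ _; exact: rk_inj.
have rk_surj n : exists x, D x /\ rk x = n.
  pose P k := `[< exists x, [/\ D x, rk x = k & (n <= k)%N] >].
  have exP : exists k, P k.
    apply: contrapT => nP; apply: Dinf; apply: sub_finite_set (rk_fin n) => x Dx.
    split=> //; rewrite ltnNge; apply/negP => nx; apply: nP; exists (rk x).
    by apply/asboolP; exists x.
  (* For the least attained rank [k >= n], the predecessors of [x] have distinct ranks below [n], so
     there are at most [n] of them and [k = n]. *)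
  case: (ex_minnP exP) => k /asboolP[x [Dx xk nk]] kmin.
  exists x; split=> //; apply/eqP; rewrite eqn_leq xk nk andbT -xk.
  have sub : [set y | D y /\ prec y x] `<=` [set y | D y /\ (rk y < n)%N].
    move=> y [Dy yx]; split=> //; rewrite ltnNge; apply/negP => ny.
    have := rk_lt _ _ Dy Dx yx; rewrite ltnNge xk => /negP; apply.
    by apply: kmin; apply/asboolP; exists y.
  have uniq_s : uniq (map rk (enum_fset (below x))).
    rewrite map_inj_in_uniq ?fset_uniq // => y z.
    have mem w : w \in enum_fset (below x) -> D w.
      move=> wb; have : w \in below x by [].
      by rewrite /below in_fset_set ?inE; [case|exact: fin].
    by move=> /mem Dy /mem Dz; apply: rk_inj.
  rewrite /rk -(size_map rk) -[leqRHS](size_iota 0); apply: uniq_leq_size => // i.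
  move=> /mapP[y yb ->]; rewrite mem_iota /= add0n.
  have : y \in below x by [].
  rewrite /below in_fset_set; last exact: fin.
  by rewrite inE => /sub[].
have [e eP] := choice rk_surj.
exists e; split; last first.
  move=> i j; have [Di ri] := eP i; have [Dj rj] := eP j.
  by rewrite rk_ltP // ri rj.
split=> [i _|i j _ _ eij|x Dx]; first by case: (eP i).
  by have [_ <-] := eP i; have [_ <-] := eP j; rewrite eij.
by exists (rk x) => //; have [? ?] := eP (rk x); apply: rk_inj.
Qed.

(** * Unions of finite sets along a null sequence, and the use of type A *)

Section TypeA.
Context (R : realType) (L : signature) (M : expansion R L).
Local Notation Def := (Def M).
Local Notation Dfun := (Dfun M).

Lemma def_andb (p q : (nat -> R) -> bool) :
  Def (fun e => p e) -> Def (fun e => q e) -> Def (fun e => p e && q e).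
Proof.
by move=> dp dq; apply: def_iff (def_and dp dq) => e; split=> /andP.
Qed.

Lemma def_pred (A : R -> Prop) t : Def (fun e => A (e 0%N)) -> Dfun t ->
  Def (fun e => A (t e)).
Proof. by move=> dA dt; exact: (def_subst (t := fun=> t)) dA. Qed.

Lemma def_pred2 (A : R -> R -> Prop) t u :
  Def (fun e => A (e 0%N) (e 1%N)) -> Dfun t -> Dfun u ->
  Def (fun e => A (t e) (u e)).
Proof.
move=> dA dt du.
by apply: (def_subst (t := fun i => if i is 0%N then t else u)) dA => -[].
Qed.

Lemma def_gap (S : R -> R -> Prop) t u v :
  Def (fun e => S (e 0%N) (e 1%N)) -> Dfun t -> Dfun u -> Dfun v ->
  Def (fun e => gap (S (t e)) (u e) (v e)).
Proof.
move=> dS dt du dv; apply: def_and; first exact: def_pred2.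
apply: (@def_forall _ _ _
  (fun s e => u e < s < u e + v e -> ~ S (t e) s)).
apply: def_imply; last first.
  apply: def_not; apply: def_pred2 => //; last exact: dfun_var.
  exact: dfun_rename.
apply: def_andb; apply: def_lt; try exact: dfun_var.
  exact: dfun_rename.
by apply: dfun_add; exact: dfun_rename.
Qed.

Lemma def_gap_record (S : R -> Prop) r :
  Def (fun e => S (e 0%N)) -> Def (fun e => gap_record S r (e 0%N)).
Proof.
move=> dS.
have dS' : Def (fun e => S (e 1%N)) by apply: def_pred => //; exact: dfun_var.
apply: def_and.
  by apply: def_andb; apply: def_lt; try exact: dfun_cst; exact: dfun_var.
apply: (@def_ex _ _ _ (fun d e => [/\ 0 < d, gap S (e 0%N) d &
  forall c', 0 < c' < e 0%N -> ~ gap S c' d])).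
apply: (@def_iff _ _ _ (fun e => 0 < e 0%N /\ (gap S (e 1%N) (e 0%N) /\
  forall c', 0 < c' < e 1%N -> ~ gap S c' (e 0%N)))).
  by move=> e; split=> [[? []]|[]].
apply: def_and; first by apply: def_lt; [exact: dfun_cst|exact: dfun_var].
apply: def_and.
  by apply: (def_gap (S := fun _ => S) (t := fun=> 0)) => //;
    [exact: dfun_cst|exact: dfun_var|exact: dfun_var].
apply: (@def_forall _ _ _
  (fun c' e => 0 < c' < e 1%N -> ~ gap S c' (e 0%N))).
apply: def_imply.
  by apply: def_andb; apply: def_lt; try exact: dfun_cst; exact: dfun_var.
apply: def_not.
by apply: (def_gap (S := fun _ => S) (t := fun=> 0)) => //;
  [exact: dfun_cst|exact: dfun_var|exact: dfun_var].
Qed.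

(** The finite sets [D h] grow as [h] decreases along [H]. Their union is ordered by time of entry,
    and by [<] among points that enter together; initial segments are then finite. *)
Lemma omega_orderable_chain (H : R -> Prop) (D : R -> R -> Prop) :
  null_seq H -> Def (fun e => H (e 0%N)) ->
  Def (fun e => D (e 0%N) (e 1%N)) ->
  (forall h, H h -> finite_set [set c | D h c]) ->
  (forall h h' c, H h -> H h' -> h' <= h -> D h c -> D h' c) ->
  omega_orderable M [set x : 'rV[R]_1 | exists2 h, H h & D h (x ord0 ord0)].
Proof.
move=> [H0 Hlim Hfin] dH dD Dfin Dmono.
pose U c := exists2 h, H h & D h c.
have dU : Def (fun e => U (e 0%N)).
  apply: (@def_iff _ _ _ (fun e => exists h, H h /\ D h (e 0%N))).
    by move=> e; split=> [[h []]|[h]]; exists h.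
  apply: (@def_ex _ _ _ (fun h e => H h /\ D h (e 0%N))); apply: def_and => //.
have dUset : definable M [set x : 'rV[R]_1 | U (x ord0 ord0)].
  by apply: definable_Def; apply: def_iff dU => e /=; rewrite mxE.
split=> //.
have [Ufin|Uinf] := pselect (finite_set [set c | U c]).
  left; apply: (sub_finite_set _ (finite_image (fun c => const_mx c) Ufin)).
  move=> x Ux; exists (x ord0 ord0) => //.
  by apply/rowP => i; rewrite [i]ord1 mxE.
right.
(* Earlier entry is expressed by an [h] that separates [x] from [y], which is directly definable. *)
pose prec x y := [/\ U x, U y & (exists h, [/\ H h, D h x & ~ D h y]) \/
  ((forall h, H h -> (D h x <-> D h y)) /\ x < y)].
have [||x y Ux Uy|x Ux|e [[eU einj esurj] eP]] := @omega_enumeration R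
    [set c | U c] prec Uinf.
- by move=> x [_ _ [[h []]//|[_]]]; rewrite ltxx.
- move=> x y z [Ux Uy xy] [_ Uz yz]; split=> //.
  case: xy yz => [[h [Hh Dx nDy]]|[xy lxy]] [[k [Hk Dy nDz]]|[yz lyz]].
  + have [hk|/ltW kh] := leP h k.
      by case: nDy; apply: Dmono Dy.
    by left; exists h; split=> // /(Dmono _ _ _ Hh Hk kh).
  + by left; exists h; split=> // Dz; apply: nDy; apply/yz.
  + by left; exists k; split=> //; apply/xy.
  + right; split; last exact: lt_trans lyz.
    by move=> h Hh; rewrite xy // yz.
- have [E|nE] := pselect (forall h, H h -> (D h x <-> D h y)).
    case: (ltgtP x y) => [xy|yx|->]; last by constructor 2.
      by constructor 1; split=> //; right.
    by constructor 3; split=> //; right; split=> // h Hh; rewrite E.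
  have [[h [Hh Dx nDy]]|nxy] := pselect (exists h, [/\ H h, D h x & ~ D h y]).
    by constructor 1; split=> //; left; exists h.
  constructor 3; split=> //; left; apply: contrapT => nyx; apply: nE => h Hh.
  split=> Dh; apply: contrapT => nDh; [apply: nxy|apply: nyx];
    by exists h.
- have [h Hh Dx] := Ux; apply: sub_finite_set (Dfin _ Hh) => y [_ [_ _]].
  case=> [[k [Hk Dy nDx]]|[yx _]]; last by apply/yx.
  have [hk|/ltW kh] := leP h k; first exact: Dmono Dy.
  by case: nDx; apply: Dmono Dx.
exists [set p : 'rV[R]_1 * 'rV[R]_1 | prec (p.1 ord0 ord0) (p.2 ord0 ord0)].
split.
  apply: definable_Def; apply: (@def_iff _ _ _ (fun e => prec (e 0%N) (e 1%N))).
    move=> f; split=> [p|[[x y] /= p E]].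
      exists (const_mx (f 0%N), const_mx (f 1%N)) => /=; first by rewrite !mxE.
      apply/rowP => i; rewrite !mxE.
      by case: splitP => j; rewrite ord1 /= => ->; rewrite !mxE.
    have := congr1 (fun z : 'rV_(1 + 1) => z ord0 (lshift 1 ord0)) E.
    have := congr1 (fun z : 'rV_(1 + 1) => z ord0 (rshift 1 ord0)) E.
    by rewrite /= row_mxEl row_mxEr !mxE /= => <- <-.
  apply: (@def_iff _ _ _ (fun e => U (e 0%N) /\ (U (e 1%N) /\
    ((exists h, H h /\ (D h (e 0%N) /\ ~ D h (e 1%N))) \/
    ((forall h, H h -> (D h (e 0%N) <-> D h (e 1%N))) /\ e 0%N < e 1%N))))).
    move=> f; split=> [[? [? [[h [? []]]|?]]]|[? ? [[h []]|?]]].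
    - by split=> //; left; exists h.
    - by split=> //; right.
    - by split=> //; split=> //; left; exists h.
    - by split=> //; split=> //; right.
  apply: def_and => //.
  apply: def_and; first by apply: def_pred => //; exact: dfun_var.
  have d1 : Def (fun e => D (e 0%N) (e 1%N)) by [].
  have d2 : Def (fun e => D (e 0%N) (e 2%N)).
    by apply: def_pred2 => //; exact: dfun_var.
  apply: def_or.
    apply: (@def_ex _ _ _ (fun h e => H h /\ (D h (e 0%N) /\ ~ D h (e 1%N)))).
    by apply: def_and => //; apply: def_and => //; apply: def_not.
  apply: def_and.
    apply: (@def_forall _ _ _ (fun h e => H h -> (D h (e 0%N) <-> D h (e 1%N)))).
    by apply: def_imply => //; apply: def_equiv.
  by apply: def_lt; exact: dfun_var.
split; first by move=> [x y] [/= Ux Uy _].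
exists (fun n => const_mx (e n)); split; last first.
  by move=> i j; rewrite /= !mxE eP.
split=> [i _|i j _ _ E|x Ux].
- by rewrite /= mxE; exact: eU.
- apply: einj; rewrite ?inE //.
  by have := congr1 (fun z : 'rV_1 => z ord0 ord0) E; rewrite /= !mxE.
- have [i _ ei] := esurj _ Ux; exists i => //.
  by apply/rowP => k; rewrite [k]ord1 mxE ei.
Qed.

(** On an interval free of the gap ends collected below, a set [S h] with [h] in [H] cannot be left
    when moving right: this would open a gap longer than some element of [H]. *)
Lemma typeA_stable_interval (H : R -> Prop) (S : R -> R -> Prop) a b :
  typeA M -> null_seq H -> Def (fun e => H (e 0%N)) ->
  Def (fun e => S (e 0%N) (e 1%N)) -> a < b ->
  (forall h, H h -> co_open (S h) a b) ->
  exists a' b', [/\ a <= a', a' < b', b' <= b &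
    (forall eps, 0 < eps ->
      exists h, [/\ H h, h < eps & forall t, a' < t < b' -> S h t]) \/
    (forall eps, 0 < eps ->
      exists h, [/\ H h, h < eps & forall t, a' < t < b' -> ~ S h t])].
Proof.
move=> hA Hnull dH dS ab So.
have [H0 Hlim Hfin] := Hnull.
(* The lower bounds on [k] and [d] make [D h] finite: finitely many [k] in [H] are at least [h], and
   each [S k] has finitely many gaps of length at least [h] starting in the interval. *)
pose D h c := a < c < b /\ exists k d, [/\ H k, H d, h <= k, h <= d & gap (S k) c d].
have dD : Def (fun e => D (e 0%N) (e 1%N)).
  apply: def_and.
    by apply: def_andb; apply: def_lt; try exact: dfun_cst; exact: dfun_var.
  apply: (@def_ex _ _ _ (fun k e => exists d,
    [/\ H k, H d, e 0%N <= k, e 0%N <= d & gap (S k) (e 1%N) d])).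
  apply: (@def_ex _ _ _ (fun d e =>
    [/\ H (e 0%N), H d, e 1%N <= e 0%N, e 1%N <= d & gap (S (e 0%N)) (e 2%N) d])).
  apply: (@def_iff _ _ _ (fun e => H (e 1%N) /\ (H (e 0%N) /\
    (e 2%N <= e 1%N /\ (e 2%N <= e 0%N /\ gap (S (e 1%N)) (e 3%N) (e 0%N)))))).
    by move=> e; split=> [[? [? [? []]]]|[]].
  apply: def_and; first by apply: def_pred => //; exact: dfun_var.
  apply: def_and => //.
  apply: def_and; first by apply: def_le; exact: dfun_var.
  apply: def_and; first by apply: def_le; exact: dfun_var.
  by apply: def_gap => //; exact: dfun_var.
have Dfin h : H h -> finite_set [set c | D h c].
  move=> Hh.
  apply: sub_finite_set (@bigcup_finite R R [set k | H k /\ h <= k]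
    (fun k => [set c | a < c < b /\ gap (S k) c h]) (Hfin _ (H0 _ Hh)) _).
    move=> c [cab [k [d [Hk Hd hk hd [Sc g]]]]]; exists k => //; split=> //.
    split=> // t /andP[ct th]; apply: g; rewrite ct /=.
    by apply: lt_le_trans th _; rewrite lerD2l.
  by move=> k _; apply: finite_gap; exact: H0.
have Dmono h h' c : H h -> H h' -> h' <= h -> D h c -> D h' c.
  move=> _ _ hh [cab [k [d [Hk Hd hk hd g]]]]; split=> //; exists k, d.
  by split=> //; exact: le_trans hh _.
have ndense : ~ somewhere_dense [set c | exists2 h, H h & D h c].
  by move=> sd; apply: hA; exists [set c | exists2 h, H h & D h c]; split;
    [exact: omega_orderable_chain Dfin Dmono|].
have [t [tab [eps e0 tD]]] : exists t, a < t < b /\ exists2 eps, 0 < eps &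
    forall c, `|c - t| < eps -> ~ exists2 h, H h & D h c.
  apply: contrapT => nt; apply: ndense; exists `]a, b[%classic; split.
  - exact: interval_is_interval.
  - exact: interval_open.
  - by exists ((a + b) / 2); rewrite /= in_itv /= !midf_lt.
  - move=> t; rewrite /= in_itv /= => tab B /nbhs_ballP[eps /= e0 eB].
    apply: contrapT => nDB; apply: nt; exists t; split=> //; exists eps => //.
    move=> c ct Dc; apply: nDB; exists c; split=> //; apply: eB.
    by rewrite -ball_normE /= distrC.
move/andP: tab => [at_ tb].
pose a' := Num.max a (t - eps); pose b' := Num.min b (t + eps).
have a't : a' < t by rewrite gt_max at_ ltrBlDr ltrDl.
have tb' : t < b' by rewrite lt_min tb ltrDl.
have aa' : a <= a' by rewrite le_max lexx.
have bb' : b' <= b by rewrite ge_min lexx.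
have up h s p : H h -> a' < s -> s < p -> p < b' -> S h s -> S h p.
  move=> Hh as_ sp pb Ss; apply: contrapT => nSp.
  have [||c [sc cp [Sc g]]] := gap_left (So h Hh) _ _ sp Ss nSp.
  - exact: le_lt_trans as_.
  - exact: lt_le_trans bb'.
  have [d Hd dpc] : exists2 d, H d & d < p - c by apply: Hlim; rewrite subr_gt0.
  apply: (tD c).
    move: as_ pb; rewrite /a' /b' gt_max lt_min => /andP[_ h1] /andP[_ h2].
    by rewrite ltr_norml; lra.
  have ex_min : exists m, [/\ H m, m <= h & m <= d].
    by have [hd|/ltW dh] := leP h d; [exists h|exists d].
  have [m [Hm mh md]] := ex_min; exists m => //.
  split; first by rewrite (lt_le_trans (le_lt_trans aa' as_) sc)
    (lt_trans cp (lt_le_trans pb bb')).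
  exists h, d; split=> //; split=> // u /andP[cu ud]; apply: g; rewrite cu /=.
  by apply: lt_trans ud _; rewrite ltrD2l.
(* If [t] lies in [S h] for arbitrarily small [h] in [H], so does the part of the interval to its
   right; otherwise [t], and with it the part to its left, is outside [S h] for all small [h] in
   [H]. *)
have [St|nSt] := pselect (forall e, 0 < e -> exists h, [/\ H h, h < e & S h t]).
  exists t, b'; split=> //; first exact: ltW.
  left=> e e_0; have [h [Hh he Sht]] := St e e_0; exists h; split=> // u /andP[tu ub].
  exact: up Sht.
exists a', t; split=> //; first exact: ltW.
right=> e e_0; apply: contrapT => nex; apply: nSt => e' e'0.
have [h Hh] : exists2 h, H h & h < Num.min e e' by apply: Hlim; rewrite lt_min e_0.
rewrite lt_min => /andP[he he']; apply: contrapT => nSt; apply: nex.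
exists h; split=> // u /andP[au ut] Su; apply: nSt; exists h; split=> //.
exact: up Su.
Qed.

End TypeA.

(** * Iterated differences *)

Section Differences.
Context (R : realType) (V W : normedModType R).
Implicit Types (f g : V -> W) (l : seq V) (x y z u : V).

Fixpoint diff l f : V -> W :=
  if l is u :: l' then diff l' (fun x => f (x + u) - f x) else f.

Lemma diffB l f g x : diff l (fun z => f z - g z) x = diff l f x - diff l g x.
Proof.
elim: l f g => //= u l IH f g; rewrite -IH; congr (diff _ _ _).
by apply/funext => z; rewrite !opprD !opprK addrACA.
Qed.

Lemma diffZ (a : R) l f x : diff l (fun z => a *: f z) x = a *: diff l f x.
Proof.
elim: l f => //= u l IH f; rewrite -IH; congr (diff _ _ _).
by apply/funext => z; rewrite scalerBr.
Qed.

Lemma diff_shift l f u x : diff l (fun z => f (z + u)) x = diff l f (x + u).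
Proof.
elim: l f => //= w l IH f; rewrite -IH; congr (diff _ _ _).
by apply/funext => z; rewrite addrAC.
Qed.

Lemma diff_cons u l f x : diff (u :: l) f x = diff l f (x + u) - diff l f x.
Proof. by rewrite /= diffB diff_shift. Qed.

Lemma diff_mem0 l f x : 0 \in l -> diff l f x = 0.
Proof.
elim: l x => // u l IH x; rewrite inE diff_cons => /orP[/eqP <-|l0].
  by rewrite addr0 subrr.
by rewrite !IH ?subrr.
Qed.

(** The expansion has [2 ^+ size l] terms, each up to sign a value of [f] at [x] plus the sum of
    some of the steps. *)
Lemma diff_norm l f x B :
  (forall z, `|z - x| <= \sum_(u <- l) `|u| -> `|f z| <= B) ->
  `|diff l f x| <= B * 2 ^+ size l.
Proof.
elim: l x => [|u l IH] x fB.
  by rewrite expr0 mulr1; apply: fB; rewrite subrr normr0 big_nil.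
rewrite diff_cons (le_trans (ler_normB _ _)) //= exprS mulrCA mulr_natl mulr2n.
apply: lerD; apply: IH => z zx; apply: fB; rewrite big_cons.
  rewrite (_ : z - x = u + (z - (x + u))); last by rewrite opprD addrCA [u + _]addrC subrK.
  by rewrite (le_trans (ler_normD _ _)) // lerD2l.
by rewrite (le_trans zx) // lerDr.
Qed.

Lemma diff_local l f g x :
  (forall z, `|z - x| <= \sum_(u <- l) `|u| -> f z = g z) ->
  diff l f x = diff l g x.
Proof.
move=> fg; apply/eqP; rewrite -subr_eq0 -normr_le0 -diffB.
rewrite -[leRHS](mul0r (2 ^+ size l)); apply: diff_norm => z /fg ->.
by rewrite subrr normr0.
Qed.

Lemma continuous_diff (T : topologicalType) j f (y u : T -> V) t :
  {for t, continuous y} -> {for t, continuous u} ->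
  (forall i, (i <= j)%N -> {for y t + u t *+ i, continuous f}) ->
  {for t, continuous (fun s => diff (nseq j (u s)) f (y s))}.
Proof.
move=> cy cu; elim: j y cy => [|j IH] y cy cf.
  by apply: continuous_comp => //; rewrite -[y t]addr0; exact: (cf 0%N).
have -> : (fun s => diff (nseq j.+1 (u s)) f (y s)) =
    (fun s => diff (nseq j (u s)) f (y s + u s) - diff (nseq j (u s)) f (y s)).
  by apply/funext => s; rewrite -diff_cons.
apply: (@continuousB R W T); apply: IH => //.
- exact: (@continuousD R V T).
- by move=> i ij; rewrite -addrA -mulrS; apply: cf.
- by move=> i ij; apply: cf; rewrite (leq_trans ij).
Qed.

(** These points, [x] plus combinations of the steps with coefficients below [N], are the base
    points of the short differences into which a long one splits. *)
Fixpoint reach N l x z : Prop :=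
  if l is u :: l' then exists2 i, (i < N)%N & reach N l' (x + u *+ i) z
  else z = x.

Lemma reach_nseq N j u x z : reach N (nseq j u) x z ->
  exists2 m, (m <= j * N)%N & z = x + u *+ m.
Proof.
elim: j x => [|j IH] x /= => [->|[i iN /IH[m mj ->]]].
  by exists 0%N; rewrite ?addr0.
exists (i + m)%N; first by rewrite mulSn leq_add // ltnW.
by rewrite mulrnDr addrA.
Qed.

Lemma reach_norm N l x z : reach N l x z ->
  `|z - x| <= (\sum_(u <- l) `|u|) *+ N.
Proof.
elim: l x => [|u l IH] x /= => [->|[i iN /IH h]].
  by rewrite subrr normr0 big_nil mul0rn.
rewrite big_cons mulrnDl.
rewrite (_ : z - x = u *+ i + (z - (x + u *+ i))); last first.
  by rewrite opprD addrCA [u *+ i + _]addrC subrK.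
rewrite (le_trans (ler_normD _ _)) // lerD // normrMn.
by rewrite ler_wpMn2l // ltnW.
Qed.

(** Telescoping in every step turns the long difference into a sum of [N ^ size l] short ones. The
    additive relation [Q] treats lower bounds, upper bounds and norm bounds at once. *)
Lemma diff_muln (Q : R -> W -> Prop) N c l f x : Q 0 0 ->
  (forall a b v w, Q a v -> Q b w -> Q (a + b) (v + w)) ->
  (forall z, reach N l x z -> Q c (diff l f z)) ->
  Q (c * N%:R ^+ size l) (diff [seq u *+ N | u <- l] f x).
Proof.
move=> Q0 QD; elim: l f x => [|u l IH] f x Qc.
  by rewrite expr0 mulr1; exact: Qc.
have -> : diff [seq w *+ N | w <- u :: l] f x = \sum_(0 <= i < N)
    diff [seq w *+ N | w <- l] (fun z => f (z + u) - f z) (x + u *+ i).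
  transitivity (\sum_(0 <= i < N) (diff [seq w *+ N | w <- l] f (x + u *+ i.+1)
      - diff [seq w *+ N | w <- l] f (x + u *+ i))).
    by rewrite telescope_sumr // [LHS]diff_cons mulr0n addr0.
  by apply: eq_bigr => i _; rewrite mulrSr addrA -diff_cons.
have -> : c * N%:R ^+ size (u :: l) = \sum_(i < N) c * N%:R ^+ size l.
  by rewrite sumr_const card_ord /= exprS mulrCA mulr_natl.
rewrite big_mkord.
apply: (big_ind2 Q) => // [a v b w|i _]; first exact: QD.
by apply: IH => z zr; apply: (Qc z); exists i.
Qed.

End Differences.

(** * Consequences of a sign condition along one direction *)

Section SignOfDifferences.
Context (R : realType) (V : normedModType R).
Implicit Types (f : V -> R) (x u v : V).

(* Monotonicity of the [j]-th difference along [u]: its value at [x] is below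
   (above) the average over the next (previous) [j * N] translates, and these
   averages are differences with the long step [u *+ N]. *)
Lemma diff_sign_bound f u x j N B :
  (forall m, (m <= 2 * (j * N))%N ->
    0 <= diff (nseq j.+1 u) f (x - u *+ (j * N) + u *+ m)) ->
  `|diff (nseq j (u *+ N)) f x| <= B ->
  `|diff (nseq j (u *+ N)) f (x - u *+ (j * N))| <= B ->
  `|diff (nseq j u) f x| * N%:R ^+ j <= B.
Proof.
set x0 := x - _ => sg Bx Bx0.
pose G m := diff (nseq j u) f (x0 + u *+ m).
have G1 m : (m <= 2 * (j * N))%N -> G m <= G m.+1.
  by move=> /sg; rewrite [diff _ _ _]diff_cons -addrA -mulrSr subr_ge0.
have Gm m k : (m + k <= 2 * (j * N))%N -> G m <= G (m + k)%N.
  elim: k => [|k IH] mk; first by rewrite addn0.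
  rewrite addnS in mk *.
  by apply: le_trans (IH (ltnW mk)) (G1 _ (ltnW mk)).
have xE : x = x0 + u *+ (j * N) by rewrite subrK.
have GxE : diff (nseq j u) f x = G (j * N)%N by rewrite /G -xE.
have up : G (j * N)%N * N%:R ^+ j <= diff (nseq j (u *+ N)) f x.
  have := @diff_muln R V R (fun a w => a <= w) N (G (j * N)%N) (nseq j u) f x.
  rewrite map_nseq size_nseq; apply=> // [a b v w|z]; first exact: lerD.
  move=> /reach_nseq[m mj ->]; rewrite xE -addrA -mulrnDr.
  by apply: Gm; rewrite mul2n -addnn leq_add2l.
have lo : diff (nseq j (u *+ N)) f x0 <= G (j * N)%N * N%:R ^+ j.
  have := @diff_muln R V R (fun a w => w <= a) N (G (j * N)%N) (nseq j u) f x0.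
  rewrite map_nseq size_nseq; apply=> // [a b v w|z]; first exact: lerD.
  move=> /reach_nseq[m mj ->]; rewrite -(subnKC mj).
  by apply: Gm; rewrite (subnKC mj) mul2n -addnn leq_addr.
rewrite GxE -[N%:R ^+ j]ger0_norm ?exprn_ge0 // -normrM ler_norml.
rewrite (le_trans up) ?andbT; last exact: le_trans (ler_norm _) Bx.
by apply: le_trans lo; move: Bx0; rewrite ler_norml => /andP[].
Qed.

(** A difference with step [eta *+ N] is a sum of differences with step [eta], hence nonnegative.
    Such multiples come arbitrarily close to [h], and the difference depends continuously on its
    step. *)
Lemma diff_ge0_small_steps f x v j a b q h :
  (forall eps, 0 < eps -> exists eta, [/\ 0 < eta, eta < eps &
    forall t, a < t < b -> 0 <= diff (nseq j (eta *: v)) f (x + t *: v)]) ->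
  a < q -> 0 < h -> q + h *+ j < b ->
  (forall i, (i <= j)%N -> {for x + q *: v + (h *: v) *+ i, continuous f}) ->
  0 <= diff (nseq j (h *: v)) f (x + q *: v).
Proof.
move=> small aq h0 qb cf; rewrite leNgt; apply/negP => neg.
pose g h' := diff (nseq j (h' *: v)) f (x + q *: v).
have cg : {for h, continuous g}.
  apply: (@continuous_diff R V R R j f (fun=> x + q *: v) (fun h' => h' *: v)) => //.
    exact: cst_continuous.
  exact: scalel_continuous.
have /cg/nbhs_ballP[rho /= rho0 rhoP] : nbhs (g h) [set y : R | y < 0].
  exact: lt_nbhsl.
have [|eta [eta0 eta_lt etaP]] := small (Num.min rho h).
  by rewrite lt_min rho0.
move: eta_lt; rewrite lt_min => /andP[eta_rho eta_h].
pose N := Num.trunc (h / eta).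
have /andP[] : N%:R <= h / eta < N.+1%:R.
  by apply: truncn_itv; rewrite divr_ge0 // ltW.
rewrite ler_pdivlMr // ltr_pdivrMr // -natr1 => hN1 hN2.
have : g (eta *+ N) < 0.
  apply: rhoP; rewrite -ball_normE /= -mulr_natl ger0_norm; lra.
rewrite ltNge => /negP; apply.
have := @diff_muln R V R (fun a w => a <= w) N 0 (nseq j (eta *: v)) f (x + q *: v).
rewrite mul0r map_nseq scalerMnl; apply=> // [? ? ? ?|z]; first exact: lerD.
move=> /reach_nseq[m mj ->]; rewrite -addrA scalerMnl -scalerDl; apply: etaP.
rewrite (lt_le_trans aq) ?lerDl ?mulrn_wge0 ?ltW //=.
apply: le_lt_trans qb; rewrite lerD2l.
apply: (@le_trans _ _ (eta *+ (j * N))); first by rewrite ler_wpMn2l // ltW.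
by rewrite mulnC mulrnA lerMn2r -mulr_natl hN1 orbT.
Qed.

End SignOfDifferences.

(* Matrices are complete and normed, but the library does not declare the join. *)
HB.instance Definition _ (R : realType) m n := Complete.on 'M[R]_(m, n).

(** Otherwise the complements of the [F i] are open and dense in the ball, and Baire's theorem gives
    a point of the ball that no [F i] covers. *)
Lemma baire_ball (R : realType) (V : completeNormedModType R) (I : countType)
    (F : I -> set V) (x0 : V) (r : R) : 0 < r ->
  (forall x, ball x0 r x -> exists i, F i x) ->
  (forall i x, ball x0 r x -> ~ F i x ->
    exists2 eps, 0 < eps & forall y, ball x eps y -> ~ F i y) ->
  exists i x1 delta, [/\ 0 < delta, ball x1 delta `<=` ball x0 r &
    ball x1 delta `<=` F i].
Proof.
move=> r0 cover Fo; apply: contrapT => nE.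
(* Adding the exterior of a smaller closed ball makes the open sets below dense in the whole space;
   numbers that code no index receive the whole space. *)
pose E := ~` closed_ball x0 (r / 2).
pose G k := if @choice.unpickle I k is Some i then (~` F i)° `|` E else setT.
have EO : open E by apply: closed_openC; exact: closed_ball_closed.
have GP k : open (G k) /\ dense (G k).
  rewrite /G; case: choice.unpickle => [i|]; last first.
    by split=> [|O O0 _]; [exact: openT|rewrite setIT].
  split; first by apply: openU => //; exact: open_interior.
  move=> O [y Oy] oO; have [ybr|ybr] := pselect (ball x0 r y); last first.
    exists y; split=> //; right; rewrite /E /= closed_ballE ?divr_gt0 //.
    rewrite /closed_ball_ /= => ys; apply: ybr; rewrite -ball_normE /=.
    by apply: (le_lt_trans ys); rewrite ltr_pdivrMr // ltr_pMr // ltrDl.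
  have /nbhs_ballP[d /= d0 dP] : nbhs y (O `&` ball x0 r).
    by apply: open_nbhs_nbhs; split=> //; apply: openI => //; exact: ball_open.
  have [z [zd nFz]] : exists z, ball y d z /\ ~ F i z.
    apply: contrapT => nz; apply: nE; exists i, y, d; split=> //.
      by move=> z /dP[].
    by move=> z zd; apply: contrapT => nF; apply: nz; exists z.
  have [Oz zr] := dP _ zd; exists z; split=> //; left.
  have [eps e0 eP] := Fo i z zr nFz.
  by apply/nbhs_ballP; exists eps.
have [||a [ab aG]] := Baire GP (O := ball x0 (r / 2)).
- by exists x0; apply: ballxx; rewrite divr_gt0.
- exact: ball_open.
have abr : ball x0 r a by apply: le_ball ab; rewrite ler_pdivrMr // ler_pMr // lerDl.
have [i Fia] := cover a abr.
have := aG (choice.pickle i) Logic.I; rewrite /G choice.pickleK => -[/interior_subset//|]; apply.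
exact: subset_closure.
Qed.

(** * Constant sign on a small ball *)

Section LocalSign.
Context (R : realType) (L : signature) (M : expansion R L) (n : nat).
Context (U : set 'rV[R]_n) (F : 'rV[R]_n -> R) (w : 'I_n -> nat).
Hypothesis hA : typeA M.
Hypothesis Uopen : open U.
Hypothesis Fcont : forall x, U x -> {for x, continuous F}.
Hypothesis Fdef : Dfun M (fun e => F (env_row n e)).

Let v : 'rV[R]_n := \row_i (w i)%:R.

(** The coordinates of [v] are natural numbers, so those of [h *: v] are repeated sums of [h]. *)
Lemma dfun_diff j (y : (nat -> R) -> 'rV[R]_n) h :
  (forall i, Dfun M (fun e => y e ord0 i)) -> Dfun M h ->
  Dfun M (fun e => diff (nseq j (h e *: v)) F (y e)).
Proof.
elim: j y => [|j IH] y dy dh; first exact: dfun_row.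
apply: dfun_ext (dfun_add (IH (fun e => y e + h e *: v) _ dh)
  (dfun_opp (IH y dy dh))) => [e|i]; first by rewrite -diff_cons.
apply: dfun_ext (dfun_add (dy i) (dfun_muln (w i) dh)) => e.
by rewrite !mxE mulr_natr.
Qed.

(** For each [x] near [x0], the sign at some rational translate [x + ratr q *: v] is constant for
    steps below some [1 / (k + 1)]. The triples [(q, k, s)] are countable, so by Baire's theorem one
    of them serves a whole ball, which is then translated. *)
Lemma local_sign j x0 rho : U x0 -> 0 < rho ->
  exists x1 delta (s : bool), [/\ 0 < delta, ball x1 delta `<=` U `&` ball x0 rho &
    forall y h, ball x1 delta y -> 0 < h < delta ->
      0 <= (-1) ^+ s * diff (nseq j (h *: v)) F y].
Proof.
move=> Ux0 rho0.
have [rho' rho'0 rho'P] : exists2 d, 0 < d & ball x0 d `<=` U `&` ball x0 rho.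
  have /nbhs_ballP[d /= d0 dP] : nbhs x0 (U `&` ball x0 rho); last by exists d.
  apply: open_nbhs_nbhs; split; first by apply: openI => //; exact: ball_open.
  by split=> //; exact: ballxx.
(* With [r = rho' / K], the points [x + t *: v + (h *: v) *+ i] for [x] in the ball of radius [r],
   [|t|] and [|h|] at most [r] and [i <= j] stay within [rho'] of [x0]. *)
pose K := 2 + (1 + j%:R) * `|v|.
have K1 : 1 <= K by rewrite /K -addrA lerDl ?addr_ge0 // mulr_ge0 // addr_ge0.
have K0 : 0 < K by rewrite (lt_le_trans _ K1).
pose r := rho' / K.
have r0 : 0 < r by rewrite divr_gt0.
have near0 x t h i : ball x0 r x -> `|t| <= r -> `|h| <= r -> (i <= j)%N ->
    (U `&` ball x0 rho) (x + t *: v + (h *: v) *+ i).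
  move=> xr tr hr ij; apply: rho'P; rewrite -ball_normE /= !opprD !addrA.
  move: xr; rewrite -ball_normE /= => xr.
  have tv : `|t *: v| <= r * `|v| by rewrite normrZ ler_wpM2r.
  have hv : `|(h *: v) *+ i| <= j%:R * (r * `|v|).
    rewrite normrMn normrZ -[_ *+ i]mulr_natl ler_pM ?mulr_ge0 ?ler_nat //.
    by rewrite ler_wpM2r.
  rewrite (le_lt_trans (ler_normB _ _)) //.
  have := ler_normB (x0 - x) (t *: v).
  have : rho' = r * K by rewrite /r divfK // gt_eqF.
  rewrite /K; nra.
have near0U x t h i xr tr hr ij := (near0 x t h i xr tr hr ij).1.
pose Psi x t h := diff (nseq j (h *: v)) F (x + t *: v).
have cPsi (T : topologicalType) (y : T -> 'rV[R]_n) (h : T -> R) a :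
    {for a, continuous y} -> {for a, continuous h} ->
    (forall i, (i <= j)%N -> U (y a + (h a *: v) *+ i)) ->
    {for a, continuous (fun b => diff (nseq j (h b *: v)) F (y b))}.
  move=> cy ch yU.
  apply: (@continuous_diff R _ R T j F y (fun b => h b *: v)) => //.
    exact: (cvg_comp h (fun k : R => k *: v) ch (@scalel_continuous R _ v (h a))).
  by move=> i ij; apply: Fcont; exact: yU.
have neg_open (T : pseudoMetricType R) (g : T -> R) a :
    {for a, continuous g} -> g a < 0 ->
    exists2 eps, 0 < eps & forall b, ball a eps b -> g b < 0.
  move=> cg ga; have /cg/nbhs_ballP[eps /= e0 eP] : nbhs (g a) [set y : R | y < 0].
    exact: lt_nbhsl.
  by exists eps.
have dPsi x t h : Dfun M t -> Dfun M h -> Dfun M (fun e => Psi x (t e) (h e)).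
  move=> dt dh; apply: dfun_diff => // i.
  apply: dfun_ext (dfun_add (dfun_cst M (x ord0 i)) (dfun_muln (w i) dt)) => e.
  by rewrite !mxE mulr_natr.
have small_inv eps : 0 < eps -> exists k : nat, k.+1%:R^-1 <= eps :> R.
  move=> e0; exists (Num.trunc eps^-1); rewrite -[leRHS]invrK lef_pV2 ?posrE ?invr_gt0 //.
  by apply/ltW/truncnS_gt.
have claim x : ball x0 r x -> exists (i : rat * nat * bool),
    [/\ 0 <= (ratr i.1.1 : R) < r, i.1.2.+1%:R^-1 <= r &
      forall h, 0 < h < i.1.2.+1%:R^-1 -> 0 <= (-1) ^+ i.2 * Psi x (ratr i.1.1) h].
  move=> xr.
  have inr t : 0 < t < r -> `|t| <= r.
    by move=> /andP[t0 tr]; rewrite ger0_norm ltW.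
  have [[H [Hnull dH]]|nH] := pselect
      (exists H : R -> Prop, null_seq H /\ Def M (fun e => H (e 0%N))).
    (* For [h >= r] this holds trivially, so closedness has to be checked only where the nodes lie
       in [U]. *)
    pose S h t := h < r -> 0 <= Psi x t h.
    have dS : Def M (fun e => S (e 0%N) (e 1%N)).
      apply: def_imply; first by apply: def_lt; [exact: dfun_var|exact: dfun_cst].
      by apply: def_le; [exact: dfun_cst|apply: dPsi; exact: dfun_var].
    have So h : H h -> co_open (S h) 0 r.
      have [H0 _ _] := Hnull => /H0 h0 t t0r.
      have [hr nS|rh []] := ltP h r; last by rewrite /S ltNge rh.
      have neg : Psi x t h < 0.
        by rewrite ltNge; apply/negP => p; apply: nS => _.
      have ct : {for t, continuous (fun t => Psi x t h)}.
        apply: (cPsi R (fun t => x + t *: v) (fun=> h) t).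
        - apply: (@continuousD R _ R); first exact: cst_continuous.
          exact: scalel_continuous.
        - exact: cst_continuous.
        - by move=> i ij; apply: near0U => //; apply: inr => //; rewrite h0.
      have [eps e0 eP] := neg_open _ _ _ ct neg.
      exists eps => // t' tt'; rewrite /S => /(_ hr); apply/negP; rewrite -ltNge.
      by apply: eP; rewrite -ball_normE /= distrC.
    have [a [b [a0 ab br alt]]] := typeA_stable_interval hA Hnull dH dS r0 So.
    have [q qab] : exists q : rat, ratr q \in `]a, b[ by exact: rat_in_itvoo.
    move: qab; rewrite in_itv /= => /andP[aq qb].
    (* The second bound ensures [ratr q + h *+ j < b] for all [h < 1 / (k + 1)]. *)
    have [k kP] := small_inv (Num.min r ((b - ratr q) / j.+1%:R))
      ltac:(by rewrite lt_min r0 divr_gt0 // subr_gt0).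
    move: kP; rewrite le_min => /andP[kr kb].
    have [H0 _ _] := Hnull.
    have [s sP] : exists s : bool, forall eps, 0 < eps -> exists h,
      [/\ 0 < h, h < eps & forall t, a < t < b -> 0 <= (-1) ^+ s * Psi x t h].
      case: alt => alt; [exists false|exists true] => eps e0.
        have [|h [Hh]] := alt (Num.min eps r); first by rewrite lt_min e0.
        rewrite lt_min => /andP[he hr] hP; exists h; split=> //; first exact: H0.
        by move=> t /hP /(_ hr); rewrite expr0 mul1r.
      have [|h [Hh]] := alt (Num.min eps r); first by rewrite lt_min e0.
      rewrite lt_min => /andP[he hr] hP; exists h; split=> //; first exact: H0.
      move=> t /hP nS; rewrite expr1 mulN1r oppr_ge0 leNgt; apply/negP => p.
      by apply: nS => _; exact: ltW.
    exists (q, k, s); split=> //=.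
      by apply/andP; split; [exact: le_trans a0 (ltW aq)|exact: lt_le_trans br].
    move=> h /andP[h0 hk].
    rewrite -[_ * _](diffZ (W := R) ((-1) ^+ s)).
    apply: (@diff_ge0_small_steps R _ (fun z => (-1) ^+ s *: F z) x v j a b) => //.
    - move=> eps /sP[h' [h'0 h'e hP]]; exists h'; split=> // t /hP.
      by rewrite (diffZ (W := R) ((-1) ^+ s)).
    - rewrite -ltrBrDl; move: hk kb; rewrite ler_pdivlMr // => hk kb.
      apply: lt_le_trans kb; rewrite -[h *+ j]mulr_natr.
      have h1 : h * j%:R <= h * j.+1%:R by rewrite ler_wpM2l ?ler_nat // ltW.
      by apply: (le_lt_trans h1); rewrite ltr_pM2r.
    - move=> i ij; apply: continuousZr => //.
      apply: Fcont; apply: near0U => //; apply: inr.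
        by rewrite (le_lt_trans a0) // (lt_le_trans qb).
      by rewrite h0 (lt_le_trans hk).
  (* Now [gap_record A r] cannot be a null sequence, so the sign at [x] itself does not oscillate
     and the translation [q = 0] suffices. *)
  pose A h := 0 <= Psi x 0 h.
  have Ao : co_open A 0 r.
    move=> h h0r /negP; rewrite -ltNge => neg.
    have ch : {for h, continuous (fun h => Psi x 0 h)}.
      apply: (cPsi R (fun=> x + 0 *: v) id h).
      - exact: cst_continuous.
      - exact: cvg_id.
      - move=> i ij; apply: near0U => //; first by rewrite normr0 ltW.
        exact: inr.
    have [eps e0 eP] := neg_open _ _ _ ch neg.
    exists eps => // t' tt'; apply/negP; rewrite -ltNge.
    by apply: eP; rewrite -ball_normE /= distrC.
  have [eps e0 [s sP]] : exists2 eps, 0 < eps & exists s : bool,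
      forall h, 0 < h < eps -> 0 <= (-1) ^+ s * Psi x 0 h.
    apply: contrapT => nE; apply: nH; exists (gap_record A r); split; last first.
      apply: def_gap_record; apply: def_le; first exact: dfun_cst.
      by apply: dPsi; [exact: dfun_cst|exact: dfun_var].
    apply: null_seq_gap_record => // eps e0; apply: contrapT => nex; apply: nE;
        exists eps => //.
      exists true => h /andP[h0 he]; rewrite expr1 mulN1r oppr_ge0 leNgt.
      by apply/negP => p; apply: nex; exists h; split=> //; exact: ltW.
    exists false => h /andP[h0 he]; rewrite expr0 mul1r leNgt.
    by apply/negP => p; apply: nex; exists h; split=> //; apply/negP; rewrite -ltNge.
  have [k kP] := small_inv (Num.min r eps) ltac:(by rewrite lt_min r0).
  move: kP; rewrite le_min => /andP[kr ke].
  exists (0, k, s); split=> //=; first by rewrite rmorph0 lexx.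
  move=> h /andP[h0 hk]; rewrite rmorph0; apply: sP.
  by rewrite h0 (lt_le_trans hk).
have [||[[q k] s] [x1 [d [d0 dr dP]]]] :=
  @baire_ball R 'rV[R]_n _ (fun i : rat * nat * bool =>
    [set x | [/\ 0 <= (ratr i.1.1 : R) < r, i.1.2.+1%:R^-1 <= r &
      forall h, 0 < h < i.1.2.+1%:R^-1 ->
        0 <= (-1) ^+ i.2 * Psi x (ratr i.1.1) h]]) x0 r r0.
- exact: claim.
- move=> [[q k] s] x xr /= nF.
  have [[q0r kr]|nqk] := pselect (0 <= (ratr q : R) < r /\ k.+1%:R^-1 <= r);
    last by exists 1 => // y _ [? ? _]; apply: nqk.
  have [h [hk neg]] : exists h, 0 < h < k.+1%:R^-1 /\ (-1) ^+ s * Psi x (ratr q) h < 0.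
    apply: contrapT => nh; apply: nF; split=> // h hk; rewrite leNgt; apply/negP => neg.
    by apply: nh; exists h.
  have cx : {for x, continuous (fun y => (-1) ^+ s * Psi y (ratr q) h)}.
    apply: continuousZr; rewrite /Psi.
    apply: (cPsi _ (fun y => y + ratr q *: v) (fun=> h) x).
    - apply: (@continuousD R _ 'rV[R]_n); first exact: cvg_id.
      exact: cst_continuous.
    - exact: cst_continuous.
    - case/andP: q0r => q0 qr; case/andP: hk => h0 hk i ij.
      apply: near0U => //; first by rewrite ger0_norm // ltW.
      by rewrite ger0_norm ?(ltW h0) // (le_trans (ltW hk)).
  have [eps e0 eP] := neg_open _ _ _ cx neg.
  by exists eps => // y /eP ny [_ _ /(_ _ hk)]; rewrite leNgt ny.
have xd : ball x1 d x1 by exact: ballxx.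
have [/= q0r kr _] := dP _ xd.
exists (x1 + ratr q *: v), (Num.min d k.+1%:R^-1), s; split.
- by rewrite lt_min d0 /= invr_gt0.
- move=> y yd; have yd' : ball x1 d (y - ratr q *: v).
    move: yd; rewrite -!ball_normE /= opprB addrA => yd.
    by apply: lt_le_trans yd _; rewrite ge_min lexx.
  have := near0 (y - ratr q *: v) (ratr q) 0 0%N (dr _ yd').
  rewrite subrK mulr0n addr0; apply=> //; last by rewrite normr0 ltW.
  by case/andP: q0r => q0 qr; rewrite ger0_norm // ltW.
move=> y h yd; rewrite lt_min => /and3P[h0 hd hk].
have yd' : ball x1 d (y - ratr q *: v).
  move: yd; rewrite -!ball_normE /= opprB addrA => yd.
  by apply: lt_le_trans yd _; rewrite ge_min lexx.
have [_ _ /(_ h)] := dP _ yd'; rewrite /Psi /= subrK; apply.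
by rewrite h0.
Qed.

End LocalSign.

(** * Bounds on differences *)

Section Bounds.
Context (R : realType) (V : normedModType R).
Implicit Types (f : V -> R) (x y u v : V).

(** Choose [N] with [N * h] between [r / 2] and [r]. Differences of order [j] with the long step are
    at most [B * 2 ^+ j], and the sign condition gains the factor [1 / N ^ j], which is at most
    [(2 * h / r) ^ j]. *)
Lemma diff_bound_of_sign f x v j (s : bool) delta B : 0 < delta ->
  (forall y, ball x delta y -> `|f y| <= B) ->
  (forall y h, ball x delta y -> 0 < h < delta ->
    0 <= (-1) ^+ s * diff (nseq j.+1 (h *: v)) f y) ->
  exists r C, [/\ 0 < r, 0 <= C & forall y h, ball x r y -> 0 < h < r ->
    `|diff (nseq j (h *: v)) f y| <= C * h ^+ j].
Proof.
move=> d0 fB sg.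
have B0 : 0 <= B by apply: le_trans (fB x (ballxx _ d0)).
(* All points at which [f] is bounded or the sign is used lie within [2 * j * r * |v|] of [y]. *)
pose K := 2 + 2 * (j%:R * `|v|).
have K2 : 2 <= K by rewrite lerDl !mulr_ge0.
have K0 : 0 < K by rewrite (lt_le_trans _ K2).
pose r := delta / K.
have r0 : 0 < r by rewrite divr_gt0.
have dE : delta = r * K by rewrite /r divfK // gt_eqF.
exists r, (B * 2 ^+ j * (2 / r) ^+ j); split=> //.
  by rewrite !mulr_ge0 ?exprn_ge0 // divr_ge0 // ltW.
move=> y h yr /andP[h0 hr].
pose N := Num.trunc (r / h).
have /andP[] : N%:R <= r / h < N.+1%:R.
  by apply: truncn_itv; rewrite divr_ge0 // ltW.
rewrite ler_pdivlMr // ltr_pdivrMr // -natr1 => N1 N2.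
have Npos : 1 <= N%:R :> R.
  rewrite (ler_nat R 1 N) truncn_ge_nat; last by rewrite divr_ge0 // ltW.
  by rewrite ler_pdivlMr // mul1r ltW.
set hv := h *: v.
have hvN : `|hv| *+ (j * N) <= r * (j%:R * `|v|).
  rewrite /hv normrZ gtr0_norm // -[leLHS]mulr_natr natrM; move: (normr_ge0 v) => v0.
  have := ler_wpM2r (mulr_ge0 (ler0n R j) v0) N1; lra.
have near y' : `|y - y'| <= 2 * (r * (j%:R * `|v|)) -> ball x delta y'.
  move=> yy'; move: yr; rewrite -!ball_normE /= => yr.
  rewrite -(subrK y x) -addrA (le_lt_trans (ler_normD _ _)) // dE /K; nra.
pose g z := (-1) ^+ s *: f z.
have gB z : `|g z| = `|f z| by rewrite normrZ normrX normrN1 expr1n mul1r.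
have gE l z : diff l g z = (-1) ^+ s * diff l f z by exact: diffZ.
have sz : \sum_(u <- nseq j (hv *+ N)) `|u| = `|hv| *+ (j * N).
  by rewrite big_nseq iter_addr_0 normrMn -mulrnA mulnC.
have far : `|hv *+ (j * N)| <= r * (j%:R * `|v|) by rewrite normrMn.
have bound z : `|y - z| <= r * (j%:R * `|v|) ->
    `|diff (nseq j (hv *+ N)) g z| <= B * 2 ^+ j.
  move=> yz; rewrite -{2}(size_nseq j (hv *+ N)); apply: diff_norm => z' z'z.
  rewrite gB; apply: fB; apply: near.
  rewrite -(subrK z y) -addrA (le_trans (ler_normD _ _)) //.
  by move: z'z; rewrite sz distrC; lra.
have rv0 : 0 <= r * (j%:R * `|v|) by apply: mulr_ge0; [exact: ltW|exact: mulr_ge0].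
have key : `|diff (nseq j hv) g y| * N%:R ^+ j <= B * 2 ^+ j.
  apply: diff_sign_bound => [m mN||].
  - rewrite gE; apply: sg; last first.
      rewrite h0 (lt_le_trans hr) // dE ler_peMr ?ltW //.
      by rewrite (lt_le_trans _ K2) // ltrDl.
    apply: near; rewrite opprD addrA opprB addrCA subrr addr0.
    rewrite -mulNrn.
    have [jm|/ltnW mj] := leqP (j * N) m.
      rewrite mulNrn distrC -mulrnBr // normrMn.
      apply: le_trans (_ : `|hv| *+ (j * N) <= _); last lra.
      by apply: ler_wpMn2l => //; rewrite leq_subLR addnn -mul2n.
    rewrite mulNrn -mulrnBr // normrMn.
    apply: le_trans (_ : `|hv| *+ (j * N) <= _); last lra.
    by apply: ler_wpMn2l => //; rewrite leq_subr.
  - by apply: bound; rewrite subrr normr0.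
  - by apply: bound; rewrite opprB addrCA subrr addr0.
have -> : `|diff (nseq j hv) f y| = `|diff (nseq j hv) g y|.
  by rewrite gE normrM normrX normrN1 expr1n mul1r.
have Nj : 0 < N%:R ^+ j :> R by rewrite exprn_gt0 // (lt_le_trans _ Npos).
rewrite -(ler_pM2r Nj) (le_trans key) //.
have -> : B * 2 ^+ j * (2 / r) ^+ j * h ^+ j * N%:R ^+ j =
    B * 2 ^+ j * (2 / r * h * N%:R) ^+ j by rewrite !exprMn !mulrA.
rewrite ler_peMr ?mulr_ge0 ?exprn_ge0 // exprn_ege1 //.
by rewrite mulrAC -mulrA mulrAC ler_pdivlMr // mul1r; nra.
Qed.

Lemma diff_nseqN f u k y :
  diff (nseq k (- u)) f y = (-1) ^+ k * diff (nseq k u) f (y - u *+ k).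
Proof.
elim: k y => [|k IH] y; first by rewrite mul1r subr0.
rewrite !diff_cons !IH exprS mulN1r mulNr -mulrN opprB -mulrBr.
by congr (_ * (_ - _)); congr diff; rewrite mulrS opprD addrA // addrAC subrK.
Qed.

Fixpoint ndiff j (phi : nat -> R) r : R :=
  if j is j'.+1 then ndiff j' phi r.+1 - ndiff j' phi r else phi r.

Lemma ndiffB j phi psi r :
  ndiff j (fun i => phi i - psi i) r = ndiff j phi r - ndiff j psi r.
Proof.
by elim: j r => //= j IH r; rewrite !IH !opprD !opprK addrACA.
Qed.

Lemma ndiff_eq0 j phi k : (forall r, (k <= r <= k + j)%N -> phi r = 0) ->
  ndiff j phi k = 0.
Proof.
elim: j k => [|j IH] k phi0 /=; first by apply: phi0; rewrite addn0 leqnn.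
rewrite !IH ?subrr // => r /andP[kr rk]; apply: phi0.
  by rewrite kr (leq_trans rk) // addnS.
by rewrite ltnW // -addSnnS.
Qed.

(** In the alternating sum only the term of index [0] survives, with coefficient [1] or [-1]. *)
Lemma norm_ndiff0 j phi : (forall r, (1 <= r <= j)%N -> phi r = 0) ->
  `|ndiff j phi 0| = `|phi 0%N|.
Proof.
elim: j => //= j IH phi0; rewrite ndiff_eq0 ?sub0r ?normrN.
  by apply: IH => r /andP[r1 rj]; apply: phi0; rewrite r1 ltnW.
by move=> r; rewrite add1n; exact: phi0.
Qed.

Lemma ndiffE j f u x r :
  ndiff j (fun i => f (x + u *+ i)) r = diff (nseq j u) f (x + u *+ r).
Proof. by elim: j r => // j IH r; rewrite diff_cons -addrA -mulrSr -!IH. Qed.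

End Bounds.

(** * From differences in one direction to mixed differences *)

Section Polarization.
Context (R : realType) (n : nat).
Implicit Types (f : 'rV[R]_n -> R) (x y : 'rV[R]_n) (w : 'I_n -> nat).

Definition dir w : 'rV[R]_n := \row_i (w i)%:R.
Definition basis i : 'rV[R]_n := delta_mx ord0 i.

Lemma norm_dir w c : (forall i, w i <= c)%N -> `|dir w| <= c%:R.
Proof.
move=> wc; rewrite [leLHS]mx_normrE; apply: bigmax_le => //= -[i j] _ /=.
by rewrite mxE ger0_norm // ler_nat.
Qed.

Lemma norm_basis i : `|basis i| <= 1.
Proof.
rewrite [leLHS]mx_normrE; apply: bigmax_le => //= -[a b] _ /=.
by rewrite mxE; case: (_ && _); rewrite ?normr1 ?normr0.
Qed.

(* The polarization identity: with steps [(1 - r/p) h e_(i_p)] for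
   [p = 1, ..., k], the mixed difference vanishes for [r = 1, ..., k], so its
   [k]-th difference in [r] at [0] is, up to sign, the value at [r = 0]; expanding
   the mixed difference instead, each of its [2 ^ k] terms contributes a [k]-th
   difference along one direction [dir w'].  Below [eta = h / k!] and
   [c p = k! / p]. *)
Lemma polarization f h eta k (c : nat -> nat) cmax l y w b B :
  (forall p, c p <= cmax)%N -> 0 <= h -> (forall i, w i <= b)%N ->
  (forall y' w', `|y' - y| <= h *+ size l ->
    (forall i, w' i <= b + size l * cmax)%N ->
    `|ndiff k (fun r => f (y' - (eta *+ r) *: dir w')) 0| <= B) ->
  `|ndiff k (fun r =>
      diff [seq (h - eta *+ (c p.1 * r)) *: basis p.2 | p <- l] f
        (y - (eta *+ r) *: dir w)) 0| <= B * 2 ^+ size l.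
Proof.
move=> cm h0; elim: l y w b => [|[p i] l IH] y w b wb fB.
  rewrite expr0 mulr1 /=; apply: fB; first by rewrite subrr normr0.
  by move=> i; rewrite addn0.
(* The part of the new step that depends on [r] is absorbed into the direction, where it adds [c p]
   to coordinate [i]. *)
pose w' i' := (w i' + (i' == i) * c p)%N.
have -> : (fun r => diff [seq (h - eta *+ (c q.1 * r)) *: basis q.2 | q <- (p, i) :: l]
    f (y - (eta *+ r) *: dir w)) =
  (fun r => diff [seq (h - eta *+ (c q.1 * r)) *: basis q.2 | q <- l]
    f (y + h *: basis i - (eta *+ r) *: dir w') -
    diff [seq (h - eta *+ (c q.1 * r)) *: basis q.2 | q <- l]
    f (y - (eta *+ r) *: dir w)).
  apply/funext => r; rewrite [LHS]diff_cons; congr (diff _ _ _ - _).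
  rewrite /= -!addrA; congr (_ + _); apply/rowP => a; rewrite !mxE /= /w' natrD natrM.
  by rewrite mulnC mulrnA -[eta *+ r *+ c p]mulr_natr; ring.
rewrite ndiffB (le_trans (ler_normB _ _)) // exprS mulrCA mulr_natl mulr2n.
have w'b i' : (w' i' <= b + cmax)%N.
  by rewrite leq_add // /w'; case: (_ == _); rewrite ?mul1n ?mul0n.
apply: lerD.
- apply: (IH _ _ (b + cmax)%N) => // y' w'' yy' ww; apply: fB; last first.
    by move=> i'; rewrite mulSn addnA.
  rewrite (_ : y' - y = h *: basis i + (y' - (y + h *: basis i))); last first.
    by rewrite [RHS]addrC opprD addrA subrK.
  rewrite (le_trans (ler_normD _ _)) // mulrS lerD // normrZ ger0_norm //.
  by rewrite ler_piMr // norm_basis.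
- apply: (IH _ _ b) => // y' w'' yy' ww; apply: fB.
    by rewrite (le_trans yy') //= mulrS lerDr.
  by move=> i'; rewrite (leq_trans (ww i')) // leq_add2l leq_mul2r leqnSn orbT.
Qed.

(** The directions produced by polarization have coordinates that are sums of at most [L] numbers
    [c p], each at most the factorial of [L]; hence the range of [w]. *)
Lemma mixed_diff_bound f x r C L : 0 < r -> 0 <= C ->
  (forall w k y h, (forall i, w i <= L * L`!)%N -> (k <= L)%N -> ball x r y ->
    0 < h < r -> `|diff (nseq k (h *: dir w)) f y| <= C * h ^+ k) ->
  exists r' C', [/\ 0 < r', 0 <= C' & forall J y h, (size J <= L)%N ->
    ball x r' y -> 0 < h < r' ->
    `|diff [seq h *: basis i | i <- J] f y| <= C' * h ^+ size J].
Proof.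
move=> r0 C0 fC.
(* The terms account for the distance from [x] to [y], the shifts by [h] along basis vectors, and
   the [k] steps along [dir w']. *)
pose K := 1 + L%:R + L%:R * (L * L`!)%:R : R.
have K1 : 1 <= K by rewrite /K -addrA lerDl addr_ge0.
have K0 : 0 < K by rewrite (lt_le_trans _ K1).
exists (r / K), (C * 2 ^+ L); split; rewrite ?divr_gt0 ?mulr_ge0 ?exprn_ge0 //.
move=> J y h JL yr /andP[h0 hr].
have hrK : h * K < r by rewrite -ltr_pdivlMr.
set k := size J; pose c p := (k`! %/ p)%N; pose eta := h / k`!%:R.
have kf0 : 0 < k`!%:R :> R by rewrite ltr0n fact_gt0.
have kf1 : 1 <= k`!%:R :> R by rewrite (ler_nat R 1) fact_gt0.
have eta0 : 0 < eta by rewrite divr_gt0.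
have etah : eta <= h by rewrite ler_pdivrMr // ler_peMr // ltW.
have kL : (k`! <= L`!)%N by apply: leq_fact.
pose l := zip (iota 1 k) J.
have sl : size l = k by rewrite size_zip size_iota minnn.
have l2 : [seq p.2 | p <- l] = J by rewrite -/(unzip2 l) unzip2_zip // size_iota.
pose phi q := diff [seq (h - eta *+ (c p.1 * q)) *: basis p.2 | p <- l] f
  (y - (eta *+ q) *: dir (fun=> 0%N)).
have phi0 : diff [seq h *: basis i | i <- J] f y = phi 0%N.
  rewrite /phi mulr0n scale0r subr0 -l2 -map_comp; congr (diff _ _ _).
  by apply: eq_map => p /=; rewrite muln0 mulr0n subr0.
(* The [q]-th step vanishes: [q] divides the factorial of [k], so [eta *+ (c q * q)] is exactly
   [h]. *)
have phi_eq0 q : (1 <= q <= k)%N -> phi q = 0.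
  move=> /andP[q1 qk]; apply: diff_mem0; apply/mapP.
  have ql : (q.-1 < size l)%N by rewrite sl prednK.
  have [i0 _] : exists i0 : 'I_n, True.
    have : (0 < size J)%N := leq_trans q1 qk.
    by case: (J) => // i s _; exists i.
  exists (nth (0%N, i0) l q.-1); first exact: mem_nth.
  rewrite nth_zip ?size_iota //= nth_iota ?prednK // add1n prednK // /c divnK; last first.
    by apply: dvdn_fact; rewrite q1.
  by rewrite -mulr_natr divfK ?gt_eqF // subrr scale0r.
rewrite phi0 -(@norm_ndiff0 R k phi) //.
have C2 : C * h ^+ k * 2 ^+ size l <= C * 2 ^+ L * h ^+ k.
  have hk0 : 0 <= h ^+ k by rewrite exprn_ge0 // ltW.
  rewrite mulrAC ler_wpM2r // ler_wpM2l //.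
  by rewrite sl ler_weXn2l // ler1n.
apply: le_trans C2; apply: (@polarization f h eta k c L`! l y _ 0%N) => //.
- by move=> p; rewrite (leq_trans (leq_div _ _)).
- exact: ltW.
move=> y' w' yy' ww'.
have wL i : (w' i <= L * L`!)%N.
  by rewrite (leq_trans (ww' i)) // add0n sl leq_mul2r JL orbT.
have -> : ndiff k (fun q => f (y' - (eta *+ q) *: dir w')) 0 =
    diff (nseq k (- (eta *: dir w'))) f y'.
  rewrite -[in RHS](addr0 y') -(mulr0n (- (eta *: dir w'))) -ndiffE.
  congr (ndiff _ _ _); apply/funext => q.
  by rewrite mulNrn (scalerMnl eta).
rewrite diff_nseqN normrM normrX normrN1 expr1n mul1r.
apply: le_trans (_ : C * eta ^+ k <= _); last first.
  by rewrite ler_wpM2l //; apply: lerXn2r => //; rewrite nnegrE ltW.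
apply: fC => //; last first.
  rewrite eta0 /= (le_lt_trans etah) // (le_lt_trans _ hrK) //.
  by rewrite ler_peMr // ltW.
move: yr; rewrite -!ball_normE /= => yr.
have e1 : `|eta *: dir w' *+ k| <= h * (L%:R * (L * L`!)%:R).
  rewrite normrMn normrZ gtr0_norm // -[_ *+ k]mulr_natr.
  have kLR : k%:R <= L%:R :> R by rewrite ler_nat.
  rewrite -mulrA; apply: ler_pM; [exact: ltW|by rewrite mulr_ge0|exact: etah|].
  by rewrite mulrC; apply: ler_pM => //; exact: norm_dir.
have e2 : `|y - y'| <= h * L%:R.
  rewrite distrC (le_trans yy') // sl -[h *+ k]mulr_natr ler_wpM2l ?ler_nat //.
  exact: ltW.
have -> : x - (y' - eta *: dir w' *+ k) = (x - y) + (y - y') + eta *: dir w' *+ k.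
  by rewrite opprB addrA [LHS]addrAC subrKA addrAC.
have := ler_normD (x - y + (y - y')) (eta *: dir w' *+ k).
have := ler_normD (x - y) (y - y').
have h1 : h * L%:R <= r / K * L%:R by rewrite ler_wpM2r // ltW.
have h2 : h * (L%:R * (L * L`!)%:R) <= r / K * (L%:R * (L * L`!)%:R).
  by rewrite ler_wpM2r ?mulr_ge0 // ltW.
have rE : r = r / K * (1 + L%:R + L%:R * (L * L`!)%:R).
  by rewrite -/K divfK // gt_eqF.
move=> n1 n2; apply: (le_lt_trans n2); move: yr h1 h2 rE; set rho := r / K; lra.
Qed.

End Polarization.

(** * Smoothness *)

Section DifferenceQuotient.
Context (R : realType) (V : normedModType R) (W : completeNormedModType R).
Context (f : V -> W) (e x : V) (r C : R).
Hypothesis e1 : `|e| <= 1.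
Hypothesis r0 : 0 < r.
Hypothesis C0 : 0 <= C.
Hypothesis diff1 : forall y h, ball x r y -> 0 < h < r ->
  `|f (y + h *: e) - f y| <= C * h.
Hypothesis diff2 : forall y h, ball x r y -> 0 < h < r ->
  `|diff [:: h *: e; h *: e] f y| <= C * h ^+ 2.

Definition quot h y := h^-1 *: (f (y + h *: e) - f y).

Lemma ball_shift y s a b : ball x a y -> `|s| <= b -> ball x (a + b) (y + s *: e).
Proof.
rewrite -!ball_normE /= => yr sr.
rewrite opprD addrA (le_lt_trans (ler_normB _ _)) // ltr_leD //.
by rewrite normrZ -[leRHS]mulr1 ler_pM.
Qed.

(** With [N] the integral part of [h / t], the increment over [h] is compared with [N] increments
    over [t]. Second differences control how these vary, at a cost of [C * h ^+ 2]; the remainder,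
    shorter than [t], costs [C * t] twice. *)
Lemma quot_cauchy y h t : ball x (r / 2) y -> 0 < t <= h -> h < r / 2 ->
  `|quot h y - quot t y| <= C * (h + 2 * (t / h)).
Proof.
move=> yr /andP[t0 th] hr.
have h0 : 0 < h by exact: lt_le_trans th.
have inr s : 0 <= s <= h -> ball x r (y + s *: e).
  move=> /andP[s0 sh]; have := @ball_shift y s _ (r / 2) yr.
  by rewrite -splitr; apply; rewrite ger0_norm // (le_trans sh) // ltW.
pose N := Num.trunc (h / t).
have /andP[] : N%:R <= h / t < N.+1%:R.
  by apply: truncn_itv; rewrite divr_ge0 // ltW.
rewrite ler_pdivlMr // ltr_pdivrMr // -natr1 => N1 N2.
pose phi s := f (y + s *: e) - f y.
pose g i := f (y + (i%:R * t) *: e + t *: e) - f (y + (i%:R * t) *: e).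
have gB i : (i <= N)%N -> `|g i - g 0%N| <= i%:R * (C * t ^+ 2).
  elim: i => [_|i IH iN]; first by rewrite subrr normr0 mul0r.
  rewrite -(subrKA (g i)) (le_trans (ler_normD _ _)) // -natr1 mulrDl mul1r addrC.
  apply: lerD; first exact: IH (ltnW iN).
  have it : 0 <= i%:R * t <= h.
    rewrite mulr_ge0 ?(ltW t0) //= (le_trans _ N1) // ler_wpM2r ?(ltW t0) //.
    by rewrite ler_nat ltnW.
  have := diff2 (inr _ it) (_ : 0 < t < r).
  rewrite !diff_cons /= /g -natr1 mulrDl mul1r scalerDl addrA; apply.
  by rewrite t0 /=; have := r0; lra.
have phiN : phi (N%:R * t) = \sum_(i < N) g i.
  pose F i := f (y + (i%:R * t) *: e).
  rewrite (eq_bigr (fun i : 'I_N => F i.+1 - F i)); last first.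
    by move=> i _; rewrite /g /F -natr1 mulrDl mul1r scalerDl addrA.
  rewrite -(big_mkord xpredT (fun i => F i.+1 - F i)) telescope_sumr //.
  by rewrite /F mul0r scale0r addr0.
have phiE : phi t = g 0%N by rewrite /g mul0r scale0r addr0.
have a1 : `|phi (N%:R * t) - phi t *+ N| <= C * h ^+ 2.
  rewrite phiN phiE -[in X in _ - X](card_ord N) -sumr_const -sumrB.
  rewrite (le_trans (ler_norm_sum _ _ _)) //.
  apply: (@le_trans _ _ (\sum_(i < N) N%:R * (C * t ^+ 2))).
    apply: ler_sum => i _; rewrite (le_trans (gB _ (ltnW (ltn_ord i)))) //.
    rewrite ler_wpM2r ?mulr_ge0 ?exprn_ge0 // ?(ltW t0) // ler_nat ltnW //.
  rewrite sumr_const card_ord -[_ *+ N]mulr_natl.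
  have -> : N%:R * (N%:R * (C * t ^+ 2)) = C * (N%:R * t) ^+ 2 by ring.
  apply: ler_wpM2l => //; apply: lerXn2r; rewrite ?nnegrE //; last exact: ltW.
  by rewrite mulr_ge0 // ltW.
have a2 : `|phi h - phi (N%:R * t)| <= C * t.
  have [<-|hN] := eqVneq (N%:R * t) h; first by rewrite subrr normr0 mulr_ge0 // ltW.
  have hN0 : 0 < h - N%:R * t by rewrite subr_gt0 lt_neqAle hN.
  have hNr : h - N%:R * t < r.
    have : 0 <= N%:R * t by rewrite mulr_ge0 // ltW.
    by have := r0; lra.
  have NtP : 0 <= N%:R * t <= h by rewrite N1 mulr_ge0 // ltW.
  have := diff1 (inr _ NtP) (_ : 0 < h - N%:R * t < r).
  have -> : y + (N%:R * t) *: e + (h - N%:R * t) *: e = y + h *: e.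
    by rewrite -addrA -scalerDl [N%:R * t + _]addrC subrK.
  rewrite hN0 hNr => /(_ isT) d1.
  rewrite /phi opprB subrKA; apply: (le_trans d1).
  by rewrite ler_wpM2l //; lra.
have a3 : `|(h / t - N%:R) *: phi t| <= C * t.
  have b0 : 0 <= h / t - N%:R by rewrite subr_ge0 ler_pdivlMr.
  have b1 : h / t - N%:R <= 1 by rewrite lerBlDr addrC ler_pdivrMr // natr1 ltW // -natr1.
  rewrite normrZ ger0_norm // -[leRHS]mul1r ler_pM //; apply: diff1.
    by have := inr 0; rewrite scale0r addr0; apply; rewrite lexx ltW.
  by rewrite t0 /=; have := r0; lra.
have -> : quot h y - quot t y =
  h^-1 *: ((phi h - phi (N%:R * t)) + (phi (N%:R * t) - phi t *+ N) -
    (h / t - N%:R) *: phi t).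
  rewrite subrKA scalerBl scaler_nat opprB subrKA scalerBr scalerA.
  rewrite /quot -/(phi h) -/(phi t).
  by rewrite mulrA mulVf ?mul1r // gt_eqF.
rewrite normrZ gtr0_norm ?invr_gt0 // mulrC ler_pdivrMr //.
rewrite (le_trans (ler_normB _ _)) //.
have := ler_normD (phi h - phi (N%:R * t)) (phi (N%:R * t) - phi t *+ N).
have -> : C * (h + 2 * (t / h)) * h = C * h ^+ 2 + 2 * (C * t).
  by field; rewrite gt_eqF.
lra.
Qed.

(** The quotients are Cauchy as the step decreases to [0], and letting [t] tend to [0] in
    [quot_cauchy] leaves the error [C * h]. *)
Lemma quot_limit y : ball x (r / 2) y -> exists g, forall h, 0 < h < r / 2 ->
  `|quot h y - g| <= C * h.
Proof.
move=> yr.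
have r2 : 0 < r / 2 by rewrite divr_gt0.
have small h eps : 0 < h -> 0 < eps -> h < r / 2 -> \forall t \near 0^'+,
    `|quot h y - quot t y| <= C * h + eps.
  move=> h0 e0 hr; near=> t.
  have t0 : 0 < t by near: t; exact: nbhs_right_gt.
  have th : t <= h by near: t; exact: nbhs_right_le.
  have te : t < eps * h / (2 * C + 1).
    near: t; apply: nbhs_right_lt; rewrite divr_gt0 ?mulr_gt0 //.
    by rewrite ltr_wpDl // mulr_ge0.
  have := quot_cauchy yr (_ : 0 < t <= h) hr; rewrite t0 th => /(_ isT) q.
  apply: (le_trans q); rewrite mulrDr lerD2l.
  move: te; rewrite ltr_pdivlMr ?ltr_wpDl ?mulr_ge0 // => te.
  rewrite !mulrA ler_pdivrMr //; have := C0; nra.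
have cv : cvg (quot t y @[t --> 0^'+]).
  apply: cauchy_cvg; apply: cauchy_exP => eps e0.
  pose h := Num.min (r / 4) (eps / 2 / (C + 1)).
  have C1 : 0 < C + 1 by rewrite ltr_wpDl.
  have h0 : 0 < h by rewrite lt_min !divr_gt0.
  have hr : h < r / 2 by rewrite gt_min; apply/orP; left; have := r0; lra.
  have he : C * h < eps / 2.
    have : h <= eps / 2 / (C + 1) by rewrite ge_min lexx orbT.
    rewrite ler_pdivlMr // => h1; have := C0; nra.
  have e2 : 0 < (eps / 2 - C * h) / 2 by rewrite divr_gt0 // subr_gt0.
  exists (quot h y).
  suff : \forall t \near 0^'+, ball (quot h y) eps (quot t y) by [].
  by apply: filterS (small h _ h0 e2 hr) => t; rewrite -ball_normE /=; lra.
exists (lim (quot t y @[t --> 0^'+])) => h /andP[h0 hr].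
set g := lim _.
have e4 eps : 0 < eps -> `|quot h y - g| <= C * h + eps.
  move=> e0; have e2 : 0 < eps / 2 by rewrite divr_gt0.
  have /cvgrPdist_lt/(_ _ e2) c1 : quot t y @[t --> 0^'+] --> g := cv.
  near (0 : R)^'+ => t.
  have h1 : `|g - quot t y| < eps / 2 by near: t; exact: c1.
  have h2 : `|quot h y - quot t y| <= C * h + eps / 2 by near: t; exact: small.
  have -> : quot h y - g = (quot h y - quot t y) - (g - quot t y).
    by rewrite opprB subrKA.
  rewrite (le_trans (ler_normB _ _)) //; lra.
by apply/ler_addgt0Pr => eps /e4.
Unshelve. all: by end_near. Qed.

(** The limit above is one-sided. The quotient with step [- t] at [y] is the one with step [t] at
    [y - t *: e], and a second difference bounds its distance to [quot t y] by [C * t]. *)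
Lemma derivable_of_diff y : ball x (r / 4) y -> derivable f y e /\
  forall h, 0 < h < r / 4 -> `|quot h y - 'D_e f y| <= C * h.
Proof.
move=> yr.
have r4 : r / 4 + r / 4 = r / 2 by field.
have inr s : `|s| <= r / 4 -> ball x (r / 2) (y + s *: e).
  by move=> sr; rewrite -r4; exact: ball_shift.
have y2 : ball x (r / 2) y.
  by have := inr 0; rewrite scale0r addr0 normr0; apply; rewrite divr_ge0 // ltW.
have [g gP] := quot_limit y2.
have limg : h^-1 *: ((f \o shift y) (h *: e) - f y) @[h --> 0^'] --> g.
  apply/cvgrPdist_lt => eps e0.
  have C1 : 0 < 2 * C + 1 by rewrite ltr_wpDl // mulr_ge0.
  near=> h.
  have h0 : h != 0 by near: h; exact: nbhs_dnbhs_neq.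
  have hr : `|h| < r / 4 by near: h; apply: dnbhs0_lt; rewrite divr_gt0.
  have he : `|h| < eps / (2 * C + 1) by near: h; apply: dnbhs0_lt; rewrite divr_gt0.
  move: he; rewrite ltr_pdivlMr // => he.
  have hC : 2 * C * `|h| < eps by have := normr_ge0 h; nra.
  rewrite distrC /= [_ + y]addrC; apply: le_lt_trans hC.
  have [hpos|hneg|h_0] := ltgtP 0 h; last by rewrite -h_0 eqxx in h0.
    rewrite gtr0_norm in hr *; last by [].
    apply: le_trans (gP h _) _; first by rewrite hpos; have := r0; lra.
    by have := C0; nra.
  rewrite ltr0_norm in hr *; last by [].
  pose t := - h; have hE : h = - t by rewrite opprK.
  have t0 : 0 < t by rewrite oppr_gt0.
  rewrite -/t in hr *; rewrite hE.
  have -> : (- t)^-1 *: (f (y + (- t) *: e) - f y) = quot t (y + (- t) *: e).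
    by rewrite /quot invrN scaleNr -scalerN opprB -addrA -scalerDl addNr scale0r addr0.
  have yt : ball x (r / 2) (y + (- t) *: e) by apply: inr; rewrite normrN gtr0_norm // ltW.
  have tr : 0 < t < r by rewrite t0; have := r0; lra.
  have yE : y + (- t) *: e + t *: e = y.
    by rewrite -addrA -scalerDl addNr scale0r addr0.
  have q2 : `|quot t (y + (- t) *: e) - quot t y| <= C * t.
    have r2r : r / 2 <= r by have := r0; lra.
    have := diff2 (le_ball r2r yt) tr; rewrite !diff_cons /= yE => d2.
    rewrite /quot yE -scalerBr normrZ gtr0_norm ?invr_gt0 //.
    by rewrite mulrC ler_pdivrMr // -mulrA -expr2 distrC.
  rewrite -(subrKA (quot t y)) (le_trans (ler_normD _ _)) //.
  have := gP t _; rewrite t0 (_ : t < r / 2) => [/(_ isT)|]; last by have := r0; lra.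
  by move: q2; lra.
have Dg : 'D_e f y = g by apply: cvg_lim limg; exact: norm_hausdorff.
split=> [|h /andP[h0 hr]]; first by apply/cvg_ex; exists g.
by rewrite Dg; apply: gP; rewrite h0; have := r0; lra.
Unshelve. all: by end_near. Qed.

End DifferenceQuotient.

(** * Functions whose mixed differences have the expected size *)

Section Tame.
Context (R : realType) (n m : nat).
Implicit Types (U : set 'rV[R]_n) (f : 'rV[R]_n -> 'rV[R]_m).

Definition tame L U f := forall x, U x -> exists r C, [/\ 0 < r, 0 <= C &
  forall (J : seq 'I_n) y h, (size J <= L)%N -> ball x r y -> 0 < h < r ->
    `|diff [seq h *: basis R i | i <- J] f y| <= C * h ^+ size J].

Lemma sum_norm_basis (J : seq 'I_n) (h : R) : 0 <= h ->
  \sum_(u <- [seq h *: basis R i | i <- J]) `|u| <= (size J)%:R * h.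
Proof.
move=> h0; rewrite big_map; elim: J => [|i J IH].
  by rewrite big_nil mul0r.
rewrite big_cons /= -natr1 mulrDl mul1r addrC lerD //.
by rewrite normrZ ger0_norm // ler_piMr // norm_basis.
Qed.

Lemma tame_quot L U f x i : tame L.+2 U f -> U x ->
  exists r C, [/\ 0 < r, 0 <= C,
    forall y, ball x r y -> derivable f y (basis R i) /\
      forall h, 0 < h < r -> `|quot f (basis R i) h y - 'D_(basis R i) f y| <= C * h &
    forall (J : seq 'I_n) y h, (size J <= L.+2)%N -> ball x r y -> 0 < h < r ->
      `|diff [seq h *: basis R i | i <- J] f y| <= C * h ^+ size J].
Proof.
move=> tf /tf[r [C [r0 C0 fC]]].
have d1 y h : ball x r y -> 0 < h < r -> `|f (y + h *: basis R i) - f y| <= C * h.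
  by move=> yr hr; exact: (fC [:: i] y h).
have d2 y h : ball x r y -> 0 < h < r ->
    `|diff [:: h *: basis R i; h *: basis R i] f y| <= C * h ^+ 2.
  by move=> yr hr; exact: (fC [:: i; i] y h).
have r4 : r / 4 <= r by lra.
exists (r / 4), C; split=> //; first by rewrite divr_gt0.
  by move=> y; exact: (derivable_of_diff (norm_basis R i) r0 C0 d1 d2).
move=> J y h JL yr /andP[h0 hr]; apply: fC => //; first exact: le_ball yr.
by rewrite h0 (lt_le_trans hr).
Qed.

(** The derivative is approximated by quotients with step [t = h / (N + 1)]. Differences of the
    quotient with steps [h] split into [(N + 1) ^ size J] differences of [f] with steps [t] and
    order one higher, which add up to [C * h ^+ size J] after division by [t]. The error tends to
    [0] as [N] grows. *)
Lemma tame_derive L U f i : tame L.+2 U f ->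
  tame L.+1 U (fun x => 'D_(basis R i) f x).
Proof.
move=> tf x Ux; have [r [C [r0 C0 fD fC]]] := tame_quot i tf Ux.
set g := fun x => 'D_(basis R i) f x.
have L0 : 0 < L.+2%:R :> R by rewrite ltr0n.
have L1 : 1 <= L.+2%:R :> R by rewrite (ler_nat R 1).
have rL : r / L.+2%:R <= r by rewrite ler_pdivrMr // ler_peMr // ltW.
(* At most [L + 1] steps, each shorter than the new radius, are added to a point within that radius;
   this stays within [r] of [x]. *)
exists (r / L.+2%:R), C; split=> //; first exact: divr_gt0.
move=> J y h JL yr /andP[h0 hr].
have near z : `|z - y| <= (size J)%:R * h -> ball x r z.
  move: yr; rewrite -!ball_normE /= => yr zy.
  rewrite -(subrKA y) (le_lt_trans (ler_normD _ _)) // (distrC y z).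
  have JL' : (size J)%:R <= L.+1%:R :> R by rewrite ler_nat.
  have : (size J)%:R * h <= L.+1%:R * (r / L.+2%:R).
    by apply: ler_pM => //; exact: ltW.
  have : r = r / L.+2%:R * (L.+1%:R + 1) by rewrite natr1 divfK // gt_eqF.
  by move: yr zy; set rho := r / _; lra.
have hr' : h < r by exact: lt_le_trans hr rL.
pose B := C * 2 ^+ size J * h.
have B0 : 0 <= B by rewrite !mulr_ge0 ?exprn_ge0 // ltW.
suff main N : `|diff [seq h *: basis R i | i <- J] g y| <= C * h ^+ size J + B / N.+1%:R.
  apply/ler_addgt0Pr => eps e0.
  apply: le_trans (main (Num.trunc (B / eps))) _; rewrite lerD2l.
  rewrite ler_pdivrMr // mulrC -ler_pdivrMr //.
  exact/ltW/truncnS_gt.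
pose t := h / N.+1%:R.
have t0 : 0 < t by rewrite divr_gt0.
have hE : h = t *+ N.+1 by rewrite -mulr_natr divfK.
have th : t <= h by rewrite ler_pdivrMr // ler_peMr ?(ler_nat R 1) // ltW.
have tr : 0 < t < r by rewrite t0 (le_lt_trans th).
pose q z := quot f (basis R i) t z.
have a1 : `|diff [seq h *: basis R i | i <- J] (fun z => g z - q z) y| <= B / N.+1%:R.
  have -> : B / N.+1%:R = C * t * 2 ^+ size [seq h *: basis R i | i <- J].
    by rewrite size_map /B /t; ring.
  apply: diff_norm => z zy; rewrite distrC.
  have [_] := fD z (near _ (le_trans zy (sum_norm_basis _ (ltW h0)))).
  exact.
have a2 : `|diff [seq h *: basis R i | i <- J] q y| <= C * h ^+ size J.
  rewrite (_ : diff _ q y = t^-1 *: diff [seq h *: basis R i | i <- J]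
    (fun z => f (z + t *: basis R i) - f z) y); last exact: diffZ.
  rewrite normrZ gtr0_norm ?invr_gt0 // mulrC ler_pdivrMr //.
  have -> : C * h ^+ size J * t =
      C * t ^+ (size J).+1 * N.+1%:R ^+ size [seq t *: basis R i | i <- J].
    by rewrite size_map hE -mulr_natr exprMn exprS; ring.
  have -> : [seq h *: basis R i | i <- J] =
      [seq u *+ N.+1 | u <- [seq t *: basis R i | i <- J]].
    by rewrite -map_comp; apply: eq_map => i' /=; rewrite scalerMnl -hE.
  apply: (diff_muln (Q := fun c w => `|w| <= c)) => [|a b v w av bw|z].
  - by rewrite normr0.
  - by rewrite (le_trans (ler_normD _ _)) // lerD.
  - move=> /reach_norm zy; apply: (fC (i :: J)) => //.
    apply: near; apply: (le_trans zy); rewrite hE mulrnAr lerMn2r.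
    by rewrite sum_norm_basis ?orbT // ltW.
have -> : diff [seq h *: basis R i | i <- J] g y =
    diff [seq h *: basis R i | i <- J] (fun z => g z - q z) y +
    diff [seq h *: basis R i | i <- J] q y by rewrite diffB subrK.
by rewrite (le_trans (ler_normD _ _)) // addrC lerD.
Qed.

(** Quotients with a fixed step are continuous at [x] and approximate the derivative near [x]
    uniformly. *)
Lemma tame_derive_continuous L U f i : open U ->
  (forall x, U x -> {for x, continuous f}) -> tame L.+2 U f ->
  forall x, U x -> {for x, continuous (fun x => 'D_(basis R i) f x)}.
Proof.
move=> Uo fc tf x Ux; have [r [C [r0 C0 fD _]]] := tame_quot i tf Ux.
have /nbhs_ballP[d /= d0 dU] : nbhs x U by exact: open_nbhs_nbhs.
apply/(@cvgrPdist_lt R _ _ (nbhs x) (nbhs_filter x)) => eps e0.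
have C1 : 0 < 4 * (C + 1) by rewrite mulr_gt0 // ltr_wpDl.
pose h := Num.min (Num.min (r / 2) (d / 2)) (eps / (4 * (C + 1))).
have h0 : 0 < h by rewrite !lt_min !divr_gt0.
have hr : h < r.
  by rewrite !gt_min; apply/orP; left; apply/orP; left; lra.
have hd : h < d.
  by rewrite !gt_min; apply/orP; left; apply/orP; right; lra.
have hC : C * h < eps / 4.
  have : h <= eps / (4 * (C + 1)) by rewrite ge_min lexx orbT.
  rewrite ler_pdivlMr // => h1; nra.
pose q y := quot f (basis R i) h y.
have cq : {for x, continuous q}.
  apply: continuousZr; apply: continuousB; last exact: fc.
  have c1 : {for x, continuous (fun y => y + h *: basis R i)}.
    apply: (@continuousD R _ 'rV[R]_n); first exact: cvg_id.
    exact: cst_continuous.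
  apply: (cvg_comp (fun y => y + h *: basis R i) f c1).
  apply: fc; apply: dU; rewrite -ball_normE /= opprD addNKr normrN normrZ.
  by rewrite gtr0_norm // (le_lt_trans _ hd) // ler_piMr ?norm_basis // ltW.
have e4 : 0 < eps / 4 by rewrite divr_gt0.
have /(@cvgrPdist_lt R _ _ (nbhs x) (nbhs_filter x))/(_ _ e4) cq' := cq.
have h0r : 0 < h < r by rewrite h0.
near=> y.
have h1 : `|q x - q y| < eps / 4 by near: y; exact: cq'.
have yr : ball x r y by near: y; exact: nbhsx_ballx.
have [_ /(_ h h0r) h2] := fD y yr.
have [_ /(_ h h0r) h3] := fD x (ballxx _ r0).
rewrite -(subrKA (q x)) -[q x - _](subrKA (q y)).
rewrite (le_lt_trans (ler_normD _ _)) //.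
have := ler_normD (q x - q y) (q y - 'D_(basis R i) f y).
rewrite distrC in h3; lra.
Unshelve. all: by end_near. Qed.

(** Each derivative costs one order, and the last one needs order two to exist and be continuous;
    hence bounds up to [k + 1]. *)
Lemma tame_Ck k U f : open U -> (forall x, U x -> {for x, continuous f}) ->
  tame k.+1 U f -> Ck k U f.
Proof.
elim: k f => [|k IH] f Uo fc tf.
  split=> //; rewrite continuous_open_subspace // => x; rewrite inE.
  exact: fc.
split=> [|i].
  by rewrite continuous_open_subspace // => x; rewrite inE; exact: fc.
split=> [x Ux|].
  by have [r [C [r0 _ fD _]]] := tame_quot i tf Ux; have [] := fD x (ballxx _ r0).
apply: IH => //; first exact: (tame_derive_continuous Uo fc tf).
exact: tame_derive.
Qed.

End Tame.

(** * The set of regular points *)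

(** The minimum of the radii and the sum of the constants serve all indices. *)
Lemma finite_uniform (R : realType) (I : finType) (P : I -> R -> R -> Prop) :
  (forall i r r' C C', P i r C -> 0 < r' -> r' <= r -> C <= C' -> P i r' C') ->
  (forall i, exists r C, [/\ 0 < r, 0 <= C & P i r C]) ->
  exists r C, [/\ 0 < r, 0 <= C & forall i, P i r C].
Proof.
move=> mono ex.
have ex' i : exists rC : R * R, [/\ 0 < rC.1, 0 <= rC.2 & P i rC.1 rC.2].
  by have [r [C H]] := ex i; exists (r, C).
have [g gP] := choice ex'.
pose r := \big[Num.min/1]_i (g i).1; pose C := \sum_i (g i).2.
have r0 : 0 < r.
  by apply: lt_bigmin => // i _; have [] := gP i.
exists r, C; split=> // [|i]; first by apply: sumr_ge0 => i _; have [] := gP i.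
have [_ _ Pi] := gP i; apply: mono Pi _ _ _ => //; first exact: bigmin_le_cond.
rewrite /C (bigD1 i) //= lerDl; apply: sumr_ge0 => i' _; by have [] := gP i'.
Qed.

Lemma diff_coord (R : realType) (n m : nat) (l : seq 'rV[R]_n)
    (f : 'rV[R]_n -> 'rV[R]_m) y c :
  diff l f y ord0 c = diff l (fun z => f z ord0 c) y.
Proof. by elim: l y => // u l IH y; rewrite !diff_cons !mxE !IH. Qed.

Section Component.
Context (R : realType) (L : signature) (M : expansion R L) (n m : nat).
Context (U : set 'rV[R]_n) (f : 'rV[R]_n -> 'rV[R]_m).
Hypothesis Udef : definable M U.
Hypothesis Uopen : open U.
Hypothesis fdef : definable_fun M U f.
Hypothesis fcont : {within U, continuous f}.

(** Extension by [0] outside [U] makes each coordinate a function definable on the whole space. *)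
Definition comp c y : R := if `[< U y >] then f y ord0 c else 0.

Lemma compE c y : U y -> comp c y = f y ord0 c.
Proof. by move=> Uy; rewrite /comp asboolT. Qed.

Lemma continuous_on_open x : U x -> {for x, continuous f}.
Proof.
by move: fcont; rewrite continuous_open_subspace // => fc Ux; apply: fc; rewrite inE.
Qed.

Lemma comp_continuous c x : U x -> {for x, continuous (comp c)}.
Proof.
move=> Ux; rewrite /prop_for /continuous_at compE //.
have h : f y ord0 c @[y --> x] --> f x ord0 c.
  by apply: (cvg_comp f (fun z : 'rV[R]_m => z ord0 c) (continuous_on_open Ux));
    exact: coord_continuous.
have E : {near nbhs x, (fun y => f y ord0 c) =1 comp c}.
  have : nbhs x U by exact: open_nbhs_nbhs.
  by apply: filterS => y Uy; rewrite compE.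
exact: cvg_trans (near_eq_cvg E) h.
Qed.

Lemma comp_definable c : Dfun M (fun e => comp c (env_row n e)).
Proof.
pose G := [set row_mx p.1 p.2 | p in
  [set p : 'rV[R]_n * 'rV[R]_m | U p.1 /\ p.2 = f p.1]].
pose tl (e : nat -> R) i := e i.+1.
have dU : Def M (fun e => U (env_row n (tl e))).
  apply: def_mem => // i; apply: (dfun_ext (t := fun e => e i.+1)).
    by move=> e; rewrite mxE.
  exact: dfun_var.
apply: (@def_iff _ _ _ (fun e => (U (env_row n (tl e)) /\
    exists y : 'rV[R]_m, G (row_mx (env_row n (tl e)) y) /\ e 0%N = y ord0 c) \/
    (~ U (env_row n (tl e)) /\ e 0%N = 0))).
  move=> e; rewrite /comp -/(tl e); case: asboolP => Ux; last first.
    by split=> [[[]|[]]|] //; right.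
  split=> [[[_ [y [[[a b] /= [Ua ->] E] ->]]]|[]]|E] //.
    by have [<- <-] := eq_row_mx E.
  left; split=> //; exists (f (env_row n (tl e))); split=> //.
  by exists (env_row n (tl e), f (env_row n (tl e))).
apply: def_or.
  apply: def_and => //.
  apply: (@def_exv _ _ _ _ (fun y e => G (row_mx (env_row n (tl e)) y) /\
    e 0%N = y ord0 c)).
  apply: def_and.
    (* The quantified row [y] occupies the first [m] entries; then come the value and, from entry
       [m + 1] on, the argument. *)
    apply: def_mem => // i; case: (split_ordP i) => j ->.
      apply: (dfun_ext (t := fun e => e (m + j.+1)%N)); last exact: dfun_var.
      by move=> e; rewrite row_mxEl mxE.
    apply: (dfun_ext (t := fun e => e j)); last exact: dfun_var.
    by move=> e; rewrite row_mxEr mxE.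
  apply: def_eq; first exact: dfun_var.
  apply: (dfun_ext (t := fun e => e c)); last exact: dfun_var.
  by move=> e; rewrite mxE.
apply: def_and; first exact: def_not.
by apply: def_eq; [exact: dfun_var|exact: dfun_cst].
Qed.

Definition signed (s : bool) j c w delta y := U y /\ forall h, 0 < h < delta ->
  0 <= (-1) ^+ s * diff (nseq j (h *: dir R w)) (comp c) y.

(** A single [delta] is both the radius of the ball and the bound on the steps, so openness follows
    by halving it. *)
Definition sign_set j c (w : 'I_n -> nat) : set 'rV[R]_n :=
  [set x | exists2 delta, 0 < delta & exists s : bool,
    forall y, ball x delta y -> signed s j c w delta y].

Lemma sign_set_ball j c w x delta (s : bool) : 0 < delta ->
  (forall y, ball x delta y -> signed s j c w delta y) ->
  ball x (delta / 2) `<=` sign_set j c w.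
Proof.
move=> d0 sg x' xx'; exists (delta / 2); first by rewrite divr_gt0.
exists s => y x'y; have [|Uy yP] := sg y.
  by rewrite (splitr delta); exact: ball_triangle x'y.
by split=> // h /andP[h0 hd]; apply: yP; rewrite h0; lra.
Qed.

Lemma open_sign_set j c w : open (sign_set j c w).
Proof.
rewrite openE => x [delta d0 [s sg]]; apply/nbhs_ballP.
by exists (delta / 2); [rewrite /= divr_gt0|exact: sign_set_ball sg].
Qed.

(** Balls are those of the sup norm, hence given by linear inequalities in the coordinates, and the
    sign [s] takes only two values. *)
Lemma def_sign_set j c w : Def M (fun e => sign_set j c w (env_row n e)).
Proof.
pose B (e : nat -> R) delta (y : 'rV[R]_n) := ball (env_row n e) delta y.
apply: (@def_iff _ _ _ (fun e => exists delta, 0 < delta /\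
    ((forall y, B e delta y -> signed false j c w delta y) \/
     (forall y, B e delta y -> signed true j c w delta y)))).
  move=> e; split=> [[d [d0 [sg|sg]]]|[d d0 [[] sg]]].
  - by exists d => //; exists false.
  - by exists d => //; exists true.
  - by exists d; split=> //; right.
  - by exists d; split=> //; left.
apply: (@def_ex _ _ _ (fun delta e => 0 < delta /\
    ((forall y, B e delta y -> signed false j c w delta y) \/
     (forall y, B e delta y -> signed true j c w delta y)))).
apply: def_and; first by apply: def_lt; [exact: dfun_cst|exact: dfun_var].
suff H s : Def M (fun e => forall y, B (fun i => e i.+1) (e 0%N) y ->
    signed s j c w (e 0%N) y) by apply: def_or; exact: H.
apply: (@def_forallv _ _ _ _ (fun y e => B (fun i => e i.+1) (e 0%N) y ->
    signed s j c w (e 0%N) y)).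
have dcoord N i0 : Dfun M (fun e => env_row N e ord0 i0).
  by apply: (dfun_ext (t := fun e => e i0)); [move=> e; rewrite mxE|exact: dfun_var].
apply: def_imply.
  (* The entries are the point [y], then [delta] at index [n], then the centre of the ball. *)
  apply: (@def_iff _ _ _ (fun e => 0 < e (n + 0)%N /\ forall i : 'I_n,
      e (n + i.+1)%N < e i + e (n + 0)%N /\ e i < e (n + i.+1)%N + e (n + 0)%N)).
    move=> e; split=> -[d0 H]; split=> //.
      move=> a i; rewrite ord1 -ball_normE /= !mxE ltr_norml.
      by have [h1 h2] := H i; apply/andP; split; lra.
    move=> i; have := H ord0 i; rewrite -ball_normE /= !mxE ltr_norml.
    by move=> /andP[h1 h2]; split; lra.
  apply: def_and; first by apply: def_lt; [exact: dfun_cst|exact: dfun_var].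
  apply: def_forall_fin => i; apply: def_and; apply: def_lt; try exact: dfun_var.
    by apply: dfun_add; exact: dfun_var.
  by apply: dfun_add; exact: dfun_var.
apply: def_and; first exact: def_mem.
apply: (@def_forall _ _ _ (fun h e => 0 < h < e (n + 0)%N -> 0 <= (-1) ^+ s *
  diff (nseq j (h *: dir R w)) (comp c) (env_row n e))).
apply: def_imply.
  by apply: def_andb; apply: def_lt; try exact: dfun_cst; exact: dfun_var.
apply: def_le; first exact: dfun_cst.
have dd : Dfun M (fun e => diff (nseq j (e 0%N *: dir R w)) (comp c)
    (env_row n (fun i => e i.+1))).
  apply: (dfun_diff (F := comp c) w (comp_definable c)) => [i|]; last exact: dfun_var.
  apply: (dfun_ext (t := fun e => e i.+1)); last exact: dfun_var.
  by move=> e; rewrite mxE.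
case: s; last by apply: dfun_ext dd => e; rewrite expr0 mul1r.
by apply: dfun_ext (dfun_opp dd) => e; rewrite expr1 mulN1r.
Qed.

Lemma comp_bounded c x : U x ->
  exists2 d, 0 < d & forall y, ball x d y -> `|comp c y| <= `|comp c x| + 1.
Proof.
move=> Ux; have := @comp_continuous c x Ux.
move=> /(@cvgrPdist_lt R _ _ (nbhs x) (nbhs_filter x))/(_ _ ltr01).
move=> /nbhs_ballP[d /= d0 dP]; exists d => // y /dP /= h.
rewrite -[comp c y](subrK (comp c x)) (le_trans (ler_normD _ _)) // addrC.
by rewrite lerD2l distrC ltW.
Qed.

(** Orders run from [1] to [K + 1] because a sign of order [j + 1] bounds differences of order [j].
    The directions are those that [mixed_diff_bound] asks for; there are finitely many, which keeps
    the set open, definable and dense. *)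
Definition regular_set K : set 'rV[R]_n :=
  [set x | U x /\ forall t : 'I_m * ({ffun 'I_n -> 'I_(K * K`!).+1} * 'I_K.+1),
    sign_set t.2.2.+1 t.1 (fun i => t.2.1 i) x].

Lemma open_regular_set K : open (regular_set K).
Proof.
rewrite openE => x [Ux sx].
have h1 : nbhs x U by exact: open_nbhs_nbhs.
have h2 : \forall y \near x, forall t : 'I_m *
    ({ffun 'I_n -> 'I_(K * K`!).+1} * 'I_K.+1),
    sign_set t.2.2.+1 t.1 (fun i => t.2.1 i) y.
  apply: (@filter_forall _ _ _ _ (nbhs_filter x)) => t.
  by apply: open_nbhs_nbhs; split; [exact: open_sign_set|exact: sx].
by apply: filterS2 h1 h2 => y Uy sy; split.
Qed.

Lemma definable_regular_set K : definable M (regular_set K).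
Proof.
apply: definable_Def; apply: def_and; last first.
  by apply: def_forall_fin => t; exact: def_sign_set.
apply: def_mem => // i; apply: (dfun_ext (t := fun e => e i)); last exact: dfun_var.
by move=> e; rewrite mxE.
Qed.

(** The finitely many conditions are achieved in turn by [local_sign], each inside the half-size
    ball of the one before, which preserves the earlier conditions. *)
Lemma regular_set_dense K : typeA M -> U `<=` closure (regular_set K).
Proof.
move=> hA.
pose T : finType := ('I_m * ({ffun 'I_n -> 'I_(K * K`!).+1} * 'I_K.+1))%type.
have step (l : seq T) : forall x rho, U x -> 0 < rho -> exists x1 d,
    [/\ 0 < d, ball x1 d `<=` U `&` ball x rho &
      forall t, t \in l -> ball x1 d `<=` sign_set t.2.2.+1 t.1 (fun i => t.2.1 i)].
  elim: l => [|t l IH] x rho Ux rho0.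
    have /nbhs_ballP[d /= d0 dP] : nbhs x (U `&` ball x rho); last by exists x, d.
    apply: open_nbhs_nbhs; split; first by apply: openI => //; exact: ball_open.
    by split=> //; exact: ballxx.
  have [x1 [d [s [d0 dU sg]]]] := local_sign (fun i => t.2.1 i : nat) hA Uopen
    (@comp_continuous t.1) (comp_definable t.1) t.2.2.+1 Ux rho0.
  have d20 : 0 < d / 2 by rewrite divr_gt0.
  have [Ux1 _] := dU _ (ballxx x1 d0).
  have [x2 [d' [d'0 d'U d'P]]] := IH x1 _ Ux1 d20.
  have d2d : d / 2 <= d by lra.
  exists x2, d'; split=> // [y /d'U[Uy yd]|t'].
    by split=> //; have [] := dU y (le_ball d2d yd).
  rewrite inE => /orP[/eqP ->|]; last exact: d'P.
  move=> y /d'U[_ yd]; apply: (sign_set_ball (s := s) d0 _ yd) => z zd.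
  by have [Uz _] := dU _ zd; split=> // h hd; exact: sg.
move=> x Ux B /nbhs_ballP[rho /= rho0 rhoB].
have [x1 [d [d0 dU dP]]] := step (enum T) x rho Ux rho0.
have [Ux1 x1B] := dU _ (ballxx x1 d0).
exists x1; split; last exact: rhoB.
by split=> // t; apply: (dP t) (ballxx x1 d0); rewrite mem_enum.
Qed.

(** Signs bound differences along each [dir w], polarization bounds the mixed differences of each
    [comp c], and the sup norm collects the coordinates. *)
Lemma tame_regular_set K : tame K (regular_set K) f.
Proof.
move=> x [Ux sx].
have /nbhs_ballP[dU /= dU0 dUP] : nbhs x U by exact: open_nbhs_nbhs.
pose T : finType := ('I_m * ({ffun 'I_n -> 'I_(K * K`!).+1} * 'I_K.+1))%type.
have [r [C [r0 C0 rP]]] := @finite_uniform R T (fun t r C => forall y h,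
    ball x r y -> 0 < h < r -> `|diff (nseq t.2.2 (h *: dir R (fun i => t.2.1 i)))
      (comp t.1) y| <= C * h ^+ t.2.2)
  ltac:(move=> t r r' C C' H r'0 r'r CC y h yr /andP[h0 hr];
    apply: le_trans (H y h (le_ball r'r yr) _) _;
    [by rewrite h0 (lt_le_trans hr)|by rewrite ler_wpM2r // exprn_ge0 // ltW])
  ltac:(move=> t; have [d d0 [s sg]] := sx t; have [b b0 bP] := comp_bounded t.1 Ux;
    apply: (@diff_bound_of_sign R _ (comp t.1) x _ _ s (Num.min d b) (`|comp t.1 x| + 1));
    [by rewrite lt_min d0
    |by move=> y yb; apply: bP; apply: le_ball yb; rewrite ge_min lexx orbT
    |move=> y h yb /andP[h0 hd]; have [|_] := sg y;
      [by apply: le_ball yb; rewrite ge_min lexx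
      |by apply; rewrite h0 (lt_le_trans hd) // ge_min lexx]]).
have mixed c : exists r C, [/\ 0 < r, 0 <= C & forall (J : seq 'I_n) y h,
    (size J <= K)%N -> ball x r y -> 0 < h < r ->
    `|diff [seq h *: basis R i | i <- J] (comp c) y| <= C * h ^+ size J].
  apply: (mixed_diff_bound r0 C0) => w k y h wK kK yr hr.
  have := rP (c, ([ffun i => inord (w i)], Ordinal (kK : (k < K.+1)%N))) y h yr hr.
  have -> : dir R (fun i => [ffun i => inord (w i)] i : 'I_(K * K`!).+1) = dir R w; last by [].
  by apply/rowP => i; rewrite !mxE ffunE inordK // ltnS.
have [r1 [C1 [r10 C10 r1P]]] := @finite_uniform R 'I_m (fun c r C =>
    forall (J : seq 'I_n) y h, (size J <= K)%N -> ball x r y -> 0 < h < r ->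
    `|diff [seq h *: basis R i | i <- J] (comp c) y| <= C * h ^+ size J)
  ltac:(move=> t r' r'' C' C'' H r'0 r'r CC J y h JK yr /andP[h0 hr];
    apply: le_trans (H J y h JK (le_ball r'r yr) _) _;
    [by rewrite h0 (lt_le_trans hr)|by rewrite ler_wpM2r // exprn_ge0 // ltW])
  mixed.
(* Division by [K + 1] keeps all nodes of a difference of order at most [K] in [U], where [comp c]
   agrees with the coordinate of [f]. *)
pose r2 := Num.min r1 (dU / K.+1%:R).
have K0 : 0 < K.+1%:R :> R by rewrite ltr0n.
have r20 : 0 < r2 by rewrite lt_min r10 divr_gt0.
exists r2, C1; split=> // J y h JK yr /andP[h0 hr].
have r21 : r2 <= r1 by rewrite ge_min lexx.
have r2U : r2 * K.+1%:R <= dU.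
  by rewrite -ler_pdivlMr // ge_min lexx orbT.
rewrite [leLHS]mx_normrE; apply: bigmax_le => [|[a c] _ /=].
  by rewrite mulr_ge0 // exprn_ge0 // ltW.
rewrite ord1 diff_coord.
rewrite (_ : diff _ _ _ = diff [seq h *: basis R i | i <- J] (comp c) y).
  apply: r1P => //; first exact: le_ball yr.
  by rewrite h0 (lt_le_trans hr).
apply: diff_local => z zy; rewrite compE //; apply: dUP.
move: yr; rewrite -!ball_normE /= => yr.
have zy' := le_trans zy (sum_norm_basis J (ltW h0)).
have JK' : (size J)%:R <= K%:R :> R by rewrite ler_nat.
have h1 : (size J)%:R * h <= K%:R * r2 by apply: ler_pM => //; exact: ltW.
rewrite -(subrKA y) (le_lt_trans (ler_normD _ _)) // (distrC y z).
by move: r2U; rewrite -natr1; lra.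
Qed.

End Component.

Theorem theorem4p11 (R : realType) (L : signature) (M : expansion R L)
  (hA : typeA M) (n m : nat) (U : set 'rV[R]_n)
  (f : 'rV[R]_n -> 'rV[R]_m)
  (Udef : definable M U) (Uopen : open U)
  (fdef : definable_fun M U f) (fcont : {within U, continuous f})
  (k : nat) :
  exists V : set 'rV[R]_n,
    [/\ V `<=` U, definable M V, open V, U `<=` closure V & Ck k V f].
Proof.
have VU : regular_set U f k.+1 `<=` U by move=> x [].
(* Order [k + 1] is what [tame_Ck] requires for class C^k. *)
exists (regular_set U f k.+1); split=> //.
- exact: definable_regular_set.
- exact: open_regular_set.
- exact: regular_set_dense hA.
- apply: tame_Ck; first exact: open_regular_set.
    by move=> x /VU; exact: continuous_on_open.
  exact: tame_regular_set.
Qed.
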